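(* Let $G = \mathrm{PSL}(2,29)$, and let $G_1, G_2$ be subgroups of $G$, both isomorphic to the alternating group $A_5$, that are not conjugate in $G$. Let $\Gamma$ be the group with presentation $$\Gamma = \langle x,y,z \mid x^2,\ y^2,\ z^3,\ (yz)^2,\ (zx)^5,\ (xy)^3 \rangle.$$ Then there exist a finite quotient group $Q$ of $\Gamma$ and a surjective homomorphism $Q \to G$ for which the pre-images of $G_1$ and $G_2$ in $Q$ are not isomorphic.
   Context: Geometrically, $\Gamma$ is the index-$2$ subgroup of orientation-preserving isometries in the group generated by reflections in the faces of the hyperbolic tetrahedron $T \subset \mathbb{H}^3$ described by the $(3,5,3)$-Coxeter diagram; the presentation above is a presentation of this Kleinian group. *)

(* Defs.v *)
From HB Require Import structures.
From mathcomp Require Import all_boot all_order all_algebra all_fingroup all_solvable all_field.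
Set Implicit Arguments. Unset Strict Implicit. Unset Printing Implicit Defensive.
Import GRing.Theory.

Local Open Scope group_scope.

Definition SL2_29_set : {set {'GL_2['F_29]}} :=
  [set u : {'GL_2['F_29]} | (\det (GLval u) == 1)%R].

Lemma SL2_29_group_set : group_set SL2_29_set.
Proof.
apply/group_setP; split; first by rewrite inE GL_1E det1.
move=> u v; rewrite !inE GL_ME => /eqP du /eqP dv.
by rewrite det_mulmx du dv mulr1.
Qed.

Canonical SL2_29 : {group {'GL_2['F_29]}} := Group SL2_29_group_set.

Definition PSL2_29_carrier := coset_of 'Z(SL2_29).
Definition PSL2_29 : {group PSL2_29_carrier} := (SL2_29 / 'Z(SL2_29))%G.

(* Main.v *)
(* Fix the epimorphism from Gamma onto PSL(2,29) given by the matrices mx_x, mx_y, mx_z.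
   The image A0 of <x, z> is an A5 of index 203. A triple of traces determines a pair of
   matrices of SL(2,29) generating an irreducible group up to conjugacy in GL(2,29), so every A5
   in PSL(2,29) is GL(2,29)-conjugate to A0, and after composing with an automorphism of
   PSL(2,29) we may assume that G1 = A0.

   The preimage of A0 in Gamma has a quotient A6 that is not the restriction of a quotient of
   Gamma. Inducing its action on 6 points gives an action of Gamma on 203 blocks of 6 points,
   and Q is the image of Gamma in Sym(203 * 6) x PSL(2,29). Let R be the kernel of Q -> PSL(2,29)
   and K_i the kernel of the action of R on the block i: then R / K_i = A6, the K_i intersect
   trivially, and they are pairwise distinct. The preimage of A0 fixes the block 0, hence maps
   onto A6. Suppose that the preimage P of G2 has a normal subgroup N with P / N = A6. As 360
   does not divide 60, R maps onto P / N; as A6 is simple and nonabelian, N meets R in some K_i.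
   So P normalises K_i, hence fixes the block i, and G2 is conjugate to A0. *)

Require Import Defs.
From Stdlib Require Import BinNat.
From HB Require Import structures.
From mathcomp Require Import all_boot all_order all_algebra all_fingroup all_solvable all_field.
From mathcomp Require Import ring.
Set Implicit Arguments. Unset Strict Implicit. Unset Printing Implicit Defensive.
Import GRing.Theory.
Local Open Scope group_scope.

(** * Simple quotients of subdirect products *)

(** Conjugation by some element of GL(2,29) carries [G1] to [G2], so nothing inside PSL(2,29)
    separates them; the difference has to come from the kernel R. Inducing from the preimage of A0
    builds the choice of one class into R: its quotients R / K_i are indexed by the cosets of A0,
    and conjugation in Q permutes the K_i as PSL(2,29) permutes these cosets. Hence an A5 whose
    preimage normalises some K_i fixes a coset, which only the conjugates of A0 do. This is why the
    K_i must be distinct: if the quotient A6 came from Gamma, all the K_i would coincide and the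
    preimages of both classes would map onto A6. The construction reaches the proof as finite tables
    only. The orders of Q and R are never computed: all counting is done with the indices 60 and
    360. Even A0 is only bounded by 60 elements; equality is supplied by the given subgroup [G1]. *)

Lemma gen_ind (gT : finGroupType) (A : {set gT}) (P : gT -> Prop) :
  P 1 -> (forall g a, P g -> a \in A -> P (g * a)) -> forall g, g \in <<A>> -> P g.
Proof.
move=> P1 PM g /gen_prodgP[n [c Ac ->]].
elim: n c Ac => [|n IHn] c Ac; first by rewrite big_ord0.
by rewrite big_ord_recr /=; apply: PM (Ac _); apply: IHn => i; apply: Ac.
Qed.

Lemma simple_nonabelian_perfect (gT : finGroupType) (G : {group gT}) :
  simple G -> ~~ abelian G -> [~: G, G] = G.
Proof.
case/simpleP=> _ /(_ [~: G, G]%G (der_normal 1 G))[] //= G'1.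
by rewrite abelianE (sameP commG1P eqP) -derg1 /= => /eqP[].
Qed.

(** Since |P : N| does not divide |P : R|, R is not inside N and so maps onto T = P / N. If no [K i]
    lay in N, each would map onto T, and so would their intersection because T is perfect; but that
    intersection is trivial. So some [K i] lies in N, and equality of indices gives [K i] = R :&: N,
    which P normalises. *)
Lemma subdirect_simple_quotient (gT : finGroupType) (P R N : {group gT})
    (I : finType) (K : I -> {group gT}) :
  R <| P -> N <| P -> simple (P / N) -> ~~ abelian (P / N) ->
  ~~ (#|P : N| %| #|P : R|) ->
  (forall i, K i <| R) -> (forall i, #|R : K i| = #|P : N|) ->
  \bigcap_i K i \subset [1 gT] -> exists i, P \subset 'N(K i).
Proof.
move=> nRP nNP simT nabT ndvd nK cK capK.
have [sRP _] := andP nRP; have [sNP nNP'] := andP nNP.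
have [_ simT2] := simpleP _ simT.
have nNR : R \subset 'N(N) by apply: subset_trans nNP'.
have RN : R / N = P / N.
  have [||//] := simT2 (R / N)%G; first exact: quotient_normal.
  move/trivgP; rewrite /= quotient_sub1 // => sRN; case/negP: ndvd.
  by rewrite -(Lagrange_index sNP sRN) dvdn_mulr.
have nontriv (A : {group gT}) : A <| R -> ~~ (A \subset N) -> A / N = P / N.
  move=> nAR nsA; have [||//] := simT2 (A / N)%G.
    by rewrite /= -RN; apply: quotient_normal.
  move/trivgP; rewrite /= quotient_sub1 ?(negPf nsA) //.
  exact: subset_trans (normal_sub nAR) nNR.
have [[i sKN]|noK] : (exists i, K i \subset N) \/ (forall i, ~~ (K i \subset N)).
- case: (boolP [exists i, K i \subset N]) => [/existsP|]; first by left.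
  by rewrite negb_exists => /forallP; right.
- exists i; have -> : K i = (R :&: N)%G; last first.
    by rewrite normsI ?normal_norm.
  apply/val_inj/eqP; rewrite eqEcard /= subsetI normal_sub // sKN /=.
  rewrite -(leq_pmul2r (indexg_gt0 R (K i))) Lagrange ?normal_sub // cK.
  by rewrite -card_quotient // -RN card_quotient // -indexgI Lagrange ?subsetIl.
(* [R] is kept in the intersection because an empty [\bigcap] is the full type. *)
have step (s : seq I) : exists2 A : {group gT}, A <| R & (A / N = P / N) /\
     A :=: R :&: \bigcap_(i <- s) K i.
  elim: s => [|i s [A nA [AN defA]]].
    by exists R; rewrite ?normal_refl // big_nil setIT.
  exists (A :&: K i)%G; first exact: normalI.
  split; last by rewrite big_cons /= defA -setIA [K i :&: _]setIC.
  apply/eqP; rewrite eqEsubset quotientS ?(subset_trans _ sRP) //=; last first.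
    exact: subset_trans (subsetIl _ _) (normal_sub nA).
  (* [A, [K i]] lies in A :&: [K i] and still maps onto P / N, which equals its own commutator
     subgroup. *)
  have -> : P / N = [~: A, K i] / N.
    rewrite quotientR ?(subset_trans (normal_sub _) nNR) // AN (nontriv (K i)) //.
    exact/esym/simple_nonabelian_perfect.
  rewrite quotientS //= subsetI commg_subl commg_subr.
  have [sA nA'] := andP nA; have [sK nK'] := andP (nK i).
  by rewrite (subset_trans sA) ?(subset_trans sK).
have [A _ [AN defA]] := step (index_enum I).
case/negP: nabT; rewrite -AN.
suff -> : A :=: 1 by rewrite quotient1 abelian1.
by apply/trivgP/(subset_trans _ capK); rewrite defA subsetIr.
Qed.

(** * From SL(2) to PSL(2) *)

Section Matrix2.
Local Open Scope ring_scope.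

Definition mx2 (R : Type) (a b c d : R) : 'M[R]_2 :=
  \matrix_(i, j) if i == 0 then if j == 0 then a else b
                 else if j == 0 then c else d.

Lemma mx2_eta (R : Type) (A : 'M[R]_2) : A = mx2 (A 0 0) (A 0 1) (A 1 0) (A 1 1).
Proof.
apply/matrixP=> i j; rewrite mxE.
by case: i j => [[|[|i]] //= li] [[|[|j]] //= lj];
  congr (A _ _); apply/val_inj.
Qed.

Lemma mx2M (R : nzRingType) (a b c d a' b' c' d' : R) :
  mx2 a b c d *m mx2 a' b' c' d' =
  mx2 (a * a' + b * c') (a * b' + b * d') (c * a' + d * c') (c * b' + d * d').
Proof.
apply/matrixP=> i j; rewrite !mxE big_ord_recl big_ord1 !mxE /=.
by case: (i == 0); case: (j == 0).
Qed.

Lemma mx2_inj (R : Type) (a b c d a' b' c' d' : R) :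
  mx2 a b c d = mx2 a' b' c' d' -> [/\ a = a', b = b', c = c' & d = d'].
Proof.
move=> /matrixP e; move: (e 0 0) (e 0 1) (e 1 0) (e 1 1).
by rewrite !mxE.
Qed.

Lemma det_mx2 (R : comNzRingType) (a b c d : R) : \det (mx2 a b c d) = a * d - b * c.
Proof.
rewrite (expand_det_row _ ord0) big_ord_recl big_ord1 /cofactor !det_mx11 !mxE /=.
by rewrite expr0 expr1 mul1r mulN1r mulrN.
Qed.

Lemma mx2N (R : nzRingType) (a b c d : R) : - mx2 a b c d = mx2 (- a) (- b) (- c) (- d).
Proof. by apply/matrixP=> i j; rewrite !mxE; case: (i == 0); case: (j == 0). Qed.

Lemma mx2_1 (R : nzRingType) : 1%:M = mx2 1 0 0 1 :> 'M[R]_2.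
Proof. by rewrite [LHS]mx2_eta !mxE. Qed.

Lemma mx2_comm_upper (R : nzRingType) (a b c d : R) :
  mx2 a b c d *m mx2 1 1 0 1 = mx2 1 1 0 1 *m mx2 a b c d -> c = 0 /\ a = d.
Proof.
rewrite !mx2M => /(@mx2_inj R)[]; rewrite !(mulr0, mulr1, mul1r, mul0r, addr0, add0r) => h1 h2 _ _.
by split; [apply: (@addrI _ a); rewrite addr0 -h1 | apply: (@addrI _ b); rewrite -h2 addrC].
Qed.

Lemma mx2_comm_lower (R : nzRingType) (a b c d : R) :
  mx2 a b c d *m mx2 1 0 1 1 = mx2 1 0 1 1 *m mx2 a b c d -> b = 0 /\ a = d.
Proof.
rewrite !mx2M => /(@mx2_inj R)[]; rewrite !(mulr0, mulr1, mul1r, mul0r, addr0, add0r) => h1 _ h2 _.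
by split; [apply: (@addrI _ a); rewrite addr0 h1 | apply: (@addIr _ c); rewrite -h2 addrC].
Qed.

End Matrix2.

Section SpecialLinear2.
Variables (F : finFieldType) (S : {group {'GL_2[F]}}).
Hypothesis SE : forall u, (u \in S) = (\det (GLval u) == 1)%R.

(** Singular matrices are sent to 1, hence the determinant hypotheses in what follows. *)
Definition gl (A : 'M[F]_2) : {'GL_2[F]} := insubd (1 : {'GL_2[F]}) A.

Lemma glK (A : 'M[F]_2) : (\det A != 0)%R -> GLval (gl A) = A.
Proof.
move=> dA; have uA : A \in unitmx by rewrite unitmxE unitfE.
by rewrite [LHS]val_insubd; case: ifP => // /negP[].
Qed.

Lemma GLval_inj : injective (@GLval 2 F).
Proof. exact: val_inj. Qed.

Lemma glM (A B : 'M[F]_2) : (\det A != 0)%R -> (\det B != 0)%R ->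
  gl (A *m B) = gl A * gl B.
Proof.
by move=> dA dB; apply: GLval_inj; rewrite GL_MxE !glK // det_mulmx mulf_neq0.
Qed.

Lemma gl_val (u : {'GL_2[F]}) : gl (GLval u) = u.
Proof.
by apply: GLval_inj; apply: glK; apply: (GL_det u).
Qed.

Lemma gl_SL (A : 'M[F]_2) : (\det A = 1)%R -> gl A \in S.
Proof. by move=> dA; rewrite SE glK dA ?oner_eq0. Qed.

Lemma SL_det (u : {'GL_2[F]}) : u \in S -> (\det (GLval u) = 1)%R.
Proof. by rewrite SE => /eqP. Qed.

(** Commuting with one upper and one lower elementary matrix already forces a matrix to be scalar;
    determinant 1 leaves the two signs. *)
Lemma SL_centerP (u : {'GL_2[F]}) :
  reflect (GLval u = 1%:M \/ GLval u = - 1%:M)%R (u \in 'Z(S)).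
Proof.
apply: (iffP idP) => [/centerP[/SL_det du cu]|uE]; last first.
  have uS : u \in S.
    rewrite SE; case: uE => ->; rewrite ?det1 // mx2_1 mx2N det_mx2.
    by apply/eqP; ring.
  apply/centerP; split=> // v _; apply: GLval_inj; rewrite !GL_MxE.
  by case: uE => ->; rewrite ?mulNmx ?mulmxN mulmx1 mul1mx.
have dup (b : F) : (\det (mx2 1 b 0 1) = 1)%R by rewrite det_mx2 mulr0 mulr1 subr0.
have dlo (c : F) : (\det (mx2 1 0 c 1) = 1)%R by rewrite det_mx2 mul0r mulr1 subr0.
have nz (A : 'M[F]_2) : (\det A = 1)%R -> (\det A != 0)%R by move=> ->; apply: oner_neq0.
have e1 : (GLval u *m GLval (gl (mx2 1 0 1 1)) = GLval (gl (mx2 1 0 1 1)) *m GLval u)%R.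
  by rewrite -2!GL_MxE (cu _ (gl_SL (dlo _))).
have e2 : (GLval u *m GLval (gl (mx2 1 1 0 1)) = GLval (gl (mx2 1 1 0 1)) *m GLval u)%R.
  by rewrite -2!GL_MxE (cu _ (gl_SL (dup _))).
move: e1 e2; rewrite (glK (nz _ (dlo _))) (glK (nz _ (dup _))).
move: du; rewrite (mx2_eta (GLval u)).
set a := GLval u _ _; set b := GLval u _ _; set c := GLval u _ _; set d := GLval u _ _.
rewrite det_mx2 => du /mx2_comm_lower[b0 ad] /mx2_comm_upper[c0 _].
move: du; rewrite b0 c0 ad mul0r subr0 -expr2 => /eqP.
by rewrite sqrf_eq1 mx2_1 mx2N oppr0 => /orP[]/eqP->; [left|right].
Qed.

Lemma norm_center_SL (u : {'GL_2[F]}) : u \in 'N('Z(S)).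
Proof.
apply: (subsetP (cent_sub _)); apply/centP=> v /SL_centerP vE; apply: GLval_inj.
by rewrite !GL_MxE; case: vE => ->; rewrite ?mulNmx ?mulmxN mulmx1 mul1mx.
Qed.

(** All of GL(2) centralises ['Z(S)], so [coset_of 'Z(S)] contains GL(2) modulo signs and [psl] is
    meaningful on every invertible matrix. The automorphisms of PSL(2) induced by GL(2) thus become
    conjugations by elements of the same type. *)
Definition psl (A : 'M[F]_2) : coset_of 'Z(S) := coset 'Z(S) (gl A).

Lemma pslM (A B : 'M[F]_2) : (\det A != 0)%R -> (\det B != 0)%R ->
  psl (A *m B)%R = psl A * psl B.
Proof. by move=> dA dB; rewrite /psl glM // coset_morphM // norm_center_SL. Qed.

Lemma psl_in (A : 'M[F]_2) : (\det A = 1)%R -> psl A \in S / 'Z(S).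
Proof. by move=> dA; apply: mem_quotient; apply: gl_SL. Qed.

Lemma psl_surj (u : coset_of 'Z(S)) :
  u \in S / 'Z(S) -> exists2 A : 'M[F]_2, (\det A = 1)%R & u = psl A.
Proof.
case/morphimP=> v _ vS ->; exists (GLval v); first exact: SL_det.
by rewrite /psl gl_val.
Qed.

Lemma psl_eq (A B : 'M[F]_2) : (\det A = 1)%R -> (\det B = 1)%R ->
  psl A = psl B -> (A = B \/ A = - B)%R.
Proof.
move=> dA dB; have [nzA nzB] : (\det A != 0)%R /\ (\det B != 0)%R.
  by rewrite dA dB oner_eq0.
move/rcoset_kercosetP => /(_ (norm_center_SL _) (norm_center_SL _)).
case/rcosetP=> z /SL_centerP zE /(congr1 (@GLval 2 F)).
by rewrite GL_MxE !glK // => ->; case: zE => ->; rewrite ?mulNmx mul1mx; [left|right].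
Qed.

Lemma pslN (A : 'M[F]_2) : (\det A = 1)%R -> psl (- A)%R = psl A.
Proof.
move=> dA; apply/esym/rcoset_kercosetP; rewrite ?norm_center_SL //.
have nzA : (\det A != 0)%R by rewrite dA oner_eq0.
have d1 : (\det (- 1%:M : 'M[F]_2) != 0)%R.
  by rewrite -scaleN1r detZ det1 mulr1 sqrrN expr1n oner_eq0.
apply/rcosetP; exists (gl (- 1%:M)%R).
  by apply/SL_centerP; right; rewrite glK.
by rewrite -glM ?mulNmx ?mul1mx ?opprK // -scaleN1r detZ mulf_neq0 // sqrrN expr1n oner_eq0.
Qed.

Lemma psl_norm (A : 'M[F]_2) : (\det A != 0)%R -> psl A \in 'N(S / 'Z(S)).
Proof.
move=> dA; apply: (subsetP (quotient_norm _ _)); apply: mem_quotient.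
apply/normP/eqP; rewrite eqEcard cardJg leqnn andbT; apply/subsetP=> _ /imsetP[u uS ->].
have ng : GLval (gl A)^-1 = invmx A by rewrite GL_VxE glK.
by rewrite SE !GL_MxE ng glK // !det_mulmx det_inv SL_det // mul1r mulVf.
Qed.

Lemma psl1 : psl 1%:M%R = 1.
Proof.
have e : gl 1%:M%R = 1 by apply: GLval_inj; rewrite glK ?det1 ?oner_eq0.
by rewrite /psl e; apply: coset_id; apply: group1.
Qed.

Lemma pslV (A B : 'M[F]_2) : (\det A = 1)%R -> (A *m B = 1%:M)%R -> psl B = (psl A)^-1.
Proof.
move=> dA e; have dB : (\det B = 1)%R.
  by have := congr1 determinant e; rewrite det_mulmx dA mul1r det1.
by apply: (mulgI (psl A)); rewrite mulgV -psl1 -pslM ?dA ?dB ?oner_eq0 // e.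
Qed.

End SpecialLinear2.

(** * Computing in PSL(2,29) *)

Local Notation F := 'F_29.

Lemma SL2_29E (u : {'GL_2[F]}) : (u \in SL2_29) = (\det (GLval u) == 1)%R.
Proof. by rewrite inE. Qed.

Definition psl29 (A : 'M[F]_2) : PSL2_29_carrier := psl SL2_29 A.

Lemma psl29M (A B : 'M[F]_2) : (\det A != 0)%R -> (\det B != 0)%R ->
  psl29 (A *m B)%R = psl29 A * psl29 B.
Proof. exact: (pslM SL2_29E). Qed.

Lemma psl29_in (A : 'M[F]_2) : (\det A = 1)%R -> psl29 A \in PSL2_29.
Proof. exact: (psl_in SL2_29E). Qed.

Lemma psl29_surj (u : PSL2_29_carrier) :
  u \in PSL2_29 -> exists2 A : 'M[F]_2, (\det A = 1)%R & u = psl29 A.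
Proof. exact: (psl_surj SL2_29E). Qed.

Lemma psl29_eq (A B : 'M[F]_2) : (\det A = 1)%R -> (\det B = 1)%R ->
  psl29 A = psl29 B -> (A = B \/ A = - B)%R.
Proof. exact: (psl_eq SL2_29E). Qed.

Lemma psl29N (A : 'M[F]_2) : (\det A = 1)%R -> psl29 (- A)%R = psl29 A.
Proof. exact: (pslN SL2_29E). Qed.

Lemma psl29V (A B : 'M[F]_2) : (\det A = 1)%R -> (A *m B = 1%:M)%R ->
  psl29 B = (psl29 A)^-1.
Proof. exact: (pslV SL2_29E). Qed.

Lemma psl29_norm (A : 'M[F]_2) : (\det A != 0)%R -> psl29 A \in 'N(PSL2_29).
Proof. exact: (psl_norm SL2_29E). Qed.

Lemma psl29_1 : psl29 1%:M%R = 1.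
Proof. exact: psl1. Qed.

(** Matrix identities over ['F_29] are evaluated on binary numbers and carried over by [phi]. *)
Definition phi (n : N) : F := (nat_of_bin n)%:R%R.

Local Arguments N.add : simpl never.
Local Arguments N.mul : simpl never.
Local Arguments N.modulo : simpl never.

Lemma nat_of_add_bin (m n : N) : nat_of_bin (N.add m n) = (nat_of_bin m + nat_of_bin n)%N.
Proof. by case: m n => [|m] [|n] //; [rewrite addn0 | apply: nat_of_add_pos]. Qed.

Lemma nat_of_mul_bin (m n : N) : nat_of_bin (N.mul m n) = (nat_of_bin m * nat_of_bin n)%N.
Proof. by case: m n => [|m] [|n] //; [rewrite muln0 | apply: nat_of_mul_pos]. Qed.

Lemma phiD (m n : N) : phi (N.add m n) = (phi m + phi n)%R.
Proof. by rewrite /phi nat_of_add_bin natrD. Qed.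

Lemma phiM (m n : N) : phi (N.mul m n) = (phi m * phi n)%R.
Proof. by rewrite /phi nat_of_mul_bin natrM. Qed.

Lemma phi29 : phi 29 = 0%R.
Proof. exact/val_inj. Qed.

Lemma phi28 : phi 28 = (- 1)%R.
Proof. exact/val_inj. Qed.

Lemma phi_mod (n : N) : phi (N.modulo n 29) = phi n.
Proof. by rewrite {2}(N.div_mod' n 29) phiD phiM phi29 mul0r add0r. Qed.

Lemma phi_surj (a : F) : exists2 n : nat, n \in iota 0 29 & a = phi (bin_of_nat n).
Proof.
exists (nat_of_ord a); first by rewrite mem_iota ltn_ord.
by rewrite /phi bin_of_natK natr_Zp.
Qed.

Lemma nat_of_bin_lt29 (k : N) : N.ltb k 29 -> (k < 29)%N.
Proof.
move=> /N.ltb_lt lk.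
have -> : 29%N = (nat_of_bin (N.sub 29 k) + nat_of_bin k)%N.
  by rewrite -nat_of_add_bin N.sub_add //; apply: N.lt_le_incl.
rewrite -[X in (X < _)%N]add0n ltn_add2r lt0n; apply/eqP=> /(congr1 bin_of_nat).
by rewrite nat_of_binK => /N.sub_0_le/N.le_ngt.
Qed.

Lemma phi_inj (m n : N) : N.ltb m 29 -> N.ltb n 29 -> phi m = phi n -> m = n.
Proof.
have val_phi k : nat_of_ord (phi k) = (nat_of_bin k %% 29)%N by apply: val_Fp_nat.
move=> /nat_of_bin_lt29 lm /nat_of_bin_lt29 ln /(congr1 (@nat_of_ord _)).
by rewrite !val_phi !modn_small // => /(can_inj nat_of_binK).
Qed.

Inductive m4 := M4 of N & N & N & N.

Definition mul4 (A B : m4) : m4 :=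
  let: M4 a b c d := A in let: M4 a' b' c' d' := B in
  M4 (N.modulo (N.add (N.mul a a') (N.mul b c')) 29)
     (N.modulo (N.add (N.mul a b') (N.mul b d')) 29)
     (N.modulo (N.add (N.mul c a') (N.mul d c')) 29)
     (N.modulo (N.add (N.mul c b') (N.mul d d')) 29).

Definition opp4 (A : m4) : m4 :=
  let: M4 a b c d := A in
  M4 (N.modulo (N.mul 28 a) 29) (N.modulo (N.mul 28 b) 29)
     (N.modulo (N.mul 28 c) 29) (N.modulo (N.mul 28 d) 29).

Definition det4 (A : m4) : N :=
  let: M4 a b c d := A in N.modulo (N.add (N.mul a d) (N.mul 28 (N.mul b c))) 29.

Definition adj4 (A : m4) : m4 :=
  let: M4 a b c d := A in
  M4 d (N.modulo (N.mul 28 b) 29) (N.modulo (N.mul 28 c) 29) a.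

(* Conditionals, unlike (&&), are short-circuited by vm_compute. *)
Definition eq4 (A B : m4) : bool :=
  let: M4 a b c d := A in let: M4 a' b' c' d' := B in
  if N.eqb a a' then if N.eqb b b' then if N.eqb c c' then N.eqb d d'
  else false else false else false.

Definition reduced4 (A : m4) : bool :=
  let: M4 a b c d := A in [&& N.ltb a 29, N.ltb b 29, N.ltb c 29 & N.ltb d 29].

Definition one4 := M4 1 0 0 1.

Definition eqpm4 (A B : m4) : bool := if eq4 A B then true else eq4 (opp4 A) B.

Definition tomx (A : m4) : 'M[F]_2 :=
  let: M4 a b c d := A in mx2 (phi a) (phi b) (phi c) (phi d).

Lemma tomxM (A B : m4) : tomx (mul4 A B) = (tomx A *m tomx B)%R.
Proof. by case: A B => a b c d [a' b' c' d']; rewrite /= mx2M !phi_mod !phiD !phiM. Qed.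

Lemma tomxN (A : m4) : tomx (opp4 A) = (- tomx A)%R.
Proof. by case: A => a b c d; rewrite /= mx2N !phi_mod !phiM phi28 !mulN1r. Qed.

Lemma tomx1 : tomx one4 = 1%:M%R.
Proof. by rewrite mx2_1. Qed.

Lemma det_tomx (A : m4) : (\det (tomx A))%R = phi (det4 A).
Proof. by case: A => a b c d; rewrite /= det_mx2 phi_mod phiD !phiM phi28 mulN1r. Qed.

Lemma eq4P (A B : m4) : reflect (A = B) (eq4 A B).
Proof.
case: A B => a b c d [a' b' c' d'] /=.
apply: (iffP idP) => [|[-> -> -> ->]]; last by rewrite !N.eqb_refl.
by do 3![case: N.eqb_spec => // ->] => /N.eqb_spec->.
Qed.

HB.instance Definition _ := hasDecEq.Build m4 eq4P.

Lemma tomx_inj (A B : m4) : reduced4 A -> reduced4 B -> tomx A = tomx B -> A = B.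
Proof.
case: A B => a b c d [a' b' c' d'] /= /and4P[? ? ? ?] /and4P[? ? ? ?].
by case/(@mx2_inj F)=> /phi_inj-> // /phi_inj-> // /phi_inj-> // /phi_inj->.
Qed.

Definition psl4 (A : m4) := psl29 (tomx A).

Definition unimod4 (A : m4) : bool := N.eqb (det4 A) 1.

Lemma unimod4_det (A : m4) : unimod4 A -> (\det (tomx A) = 1)%R.
Proof. by move/N.eqb_spec; rewrite det_tomx => ->. Qed.

Lemma psl4M (A B : m4) : unimod4 A -> unimod4 B -> psl4 (mul4 A B) = psl4 A * psl4 B.
Proof.
by move=> /unimod4_det dA /unimod4_det dB; rewrite /psl4 tomxM psl29M ?dA ?dB ?oner_eq0.
Qed.

Lemma psl4_eqpm (A B : m4) : unimod4 A -> eqpm4 A B -> psl4 A = psl4 B.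
Proof.
move=> /unimod4_det dA; rewrite /eqpm4; case: eq4P => [-> // | _ /eq4P <-].
by rewrite /psl4 tomxN psl29N.
Qed.

(** This direction lets a computation refute an equality in PSL(2,29), as when a coset
    representative is shown to lie outside A0. *)
Lemma psl4_inj (A B : m4) : unimod4 A -> unimod4 B -> reduced4 A -> reduced4 B ->
  psl4 A = psl4 B -> eqpm4 A B.
Proof.
move=> uA uB rA rB /psl29_eq[]; rewrite ?unimod4_det // /eqpm4.
  by move=> /tomx_inj-> //; case: eq4P.
rewrite -tomxN => e; case: eq4P => // _; apply/eq4P/esym.
have rO : reduced4 (opp4 A).
  by case: (A) => a b c d; apply/and4P; split; apply/N.ltb_lt; apply: N.mod_lt.
apply: tomx_inj => //; rewrite tomxN.
by move: e; rewrite tomxN => ->; rewrite opprK.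
Qed.

Lemma psl4_1 : psl4 one4 = 1.
Proof. by rewrite /psl4 tomx1 psl29_1. Qed.

Lemma psl4V (A : m4) : unimod4 A -> psl4 (adj4 A) = (psl4 A)^-1.
Proof.
move=> /unimod4_det dA; apply: psl29V => //.
move: dA; case: A => a b c d; rewrite /= !phi_mod !phiM phi28 det_mx2 mx2_1 mx2M => e.
by congr mx2; try (by ring); rewrite -[RHS]e; ring.
Qed.

(** * Conjugacy of the icosahedral subgroups *)

Section TraceConditions.
Local Open Scope ring_scope.
Variables (R : fieldType) (a b c d : R).
Hypotheses (det1 : a * d - b * c = 1).
Let A := mx2 a b c d.
Let t := a + d.

(* Cayley-Hamilton: if A ^ n = p A - q then A ^ (n + 1) = (p t - q) A - p. *)
Lemma unimodular_power_step (p q : R) :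
  mx2 (p * a - q) (p * b) (p * c) (p * d - q) *m A =
  mx2 ((p * t - q) * a - p) ((p * t - q) * b) ((p * t - q) * c) ((p * t - q) * d - p).
Proof.
have e : a * d = 1 + b * c by rewrite -det1; ring.
rewrite mx2M /t; congr mx2; try by ring.
- transitivity ((p * (a + d) - q) * a + p * (b * c) - p * (a * d)); first by ring.
  by rewrite e; ring.
- transitivity ((p * (a + d) - q) * d + p * (b * c) - p * (a * d)); first by ring.
  by rewrite e; ring.
Qed.

(** The matrix is p A - q. With p invertible A would be scalar, hence 1 or -1 by its determinant. In
    A ^ n = p A - q the coefficient p is a polynomial in the trace t, so finite order modulo sign
    becomes an equation for t. *)
Lemma nonscalar_combination (p q : R) :
  A <> 1%:M -> A <> - 1%:M ->
  mx2 (p * a - q) (p * b) (p * c) (p * d - q) = 1%:M \/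
  mx2 (p * a - q) (p * b) (p * c) (p * d - q) = - 1%:M -> p = 0.
Proof.
move=> nA nNA h; apply/eqP/negPn/negP => p0; have pI := mulfI p0.
have [pad pb pc] : [/\ p * a = p * d, p * b = 0 & p * c = 0].
  case: h; rewrite mx2_1 ?mx2N ?oppr0 => /(@mx2_inj R)[h1 -> -> h4]; split => //;
  by apply: (@addIr _ (- q)); rewrite h1 h4.
have ad := pI _ _ pad; have b0 : b = 0 by apply: pI; rewrite mulr0.
have c0 : c = 0 by apply: pI; rewrite mulr0.
move: det1 nA nNA; rewrite /A mx2_1 mx2N oppr0 ad b0 c0 mul0r subr0 -expr2 => /eqP.
by rewrite sqrf_eq1 => /orP[]/eqP->.
Qed.

Lemma unimodular_square : A *m A = mx2 (t * a - 1) (t * b) (t * c) (t * d - 1).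
Proof.
have -> : A *m A = mx2 (1 * a - 0) (1 * b) (1 * c) (1 * d - 0) *m A.
  by rewrite !mul1r !subr0.
by rewrite unimodular_power_step mul1r subr0.
Qed.

Lemma trace_of_order2 : A <> 1%:M -> A <> - 1%:M ->
  A *m A = 1%:M \/ A *m A = - 1%:M -> t = 0.
Proof. by rewrite unimodular_square; apply: nonscalar_combination. Qed.

Lemma trace_of_order3 : A <> 1%:M -> A <> - 1%:M ->
  A *m A *m A = 1%:M \/ A *m A *m A = - 1%:M -> t ^+ 2 = 1.
Proof.
rewrite unimodular_square unimodular_power_step => nA nNA.
by move=> /(nonscalar_combination nA nNA)/eqP; rewrite -expr2 subr_eq0 => /eqP.
Qed.

(** For n = 5 the coefficient p is t ^ 4 - 3 t ^ 2 + 1, which splits into these two quadratics. *)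
Lemma trace_of_order5 : A <> 1%:M -> A <> - 1%:M ->
  A *m A *m A *m A *m A = 1%:M \/ A *m A *m A *m A *m A = - 1%:M ->
  (t ^+ 2 - t - 1) * (t ^+ 2 + t - 1) = 0.
Proof.
rewrite unimodular_square !unimodular_power_step => nA nNA.
by move=> /(nonscalar_combination nA nNA) <-; ring.
Qed.

End TraceConditions.

(** The rows of g are r and r U, for a row vector r that is not an eigenvector of U; the relation
    then says U ^ 2 = -1. One of (1, 0), (0, 1), (1, 1) serves, the last one when U is diagonal,
    with eigenvalues a and -a that differ because 2 is invertible. *)
Lemma involution_companion (R : fieldType) (a b c : R) :
  (2%:R != 0 :> R)%R -> (a * - a - b * c = 1)%R ->
  exists2 g : 'M[R]_2, (\det g != 0)%R &
    (g *m mx2 a b c (- a) = mx2 0 1 (- 1) 0 *m g)%R.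
Proof.
move=> two det1; have e : (b * c = - 1 - a * a)%R by rewrite -det1; ring.
have [b0|b0] := eqVneq b 0%R; last first.
  exists (mx2 1 0 a b)%R; first by rewrite det_mx2 mul1r mul0r subr0.
  by rewrite !mx2M; congr mx2; rewrite ?[in LHS]e; ring.
have [c0|c0] := eqVneq c 0%R; last first.
  exists (mx2 0 1 c (- a))%R; first by rewrite det_mx2 mul1r mul0r sub0r oppr_eq0.
  by rewrite !mx2M; congr mx2; rewrite ?[(c * b)%R]mulrC ?e; ring.
move: det1 e; rewrite b0 c0 mul0r subr0 => det1 e.
have a0 : a != 0%R by apply/eqP=> a0; move/eqP: det1; rewrite a0 mul0r eq_sym oner_eq0.
exists (mx2 1 1 a (- a))%R.
  rewrite det_mx2 (_ : _ - _ = - (2%:R * a))%R; last by ring.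
  by rewrite oppr_eq0 mulf_neq0.
have e2 : (a * a = - 1)%R by rewrite -det1; ring.
by rewrite !mx2M; congr mx2; rewrite ?mulrNN ?mul1r ?mulN1r ?mulrN ?e2; ring.
Qed.

Lemma mxtrace_mx2 (R : nzRingType) (a b c d : R) : (\tr (mx2 a b c d) = a + d)%R.
Proof. by rewrite /mxtrace big_ord_recl big_ord1 !mxE. Qed.

Definition field29 := [seq bin_of_nat n | n <- iota 0 29].

Definition mx_x := M4 0 1 28 0.
Definition mx_y := M4 1 7 8 28.
Definition mx_z := M4 8 7 2 20.
(* An element of order 3 of A0. The traces of x z and x z' are the two roots of t ^ 2 - t - 1. *)
Definition mx_z' := M4 3 21 27 25.

(* The matrices ((p, q), (-q, p)) centralise x, and the ((p, q), (q, -p)) conjugate x to -x. *)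
Definition twist4 (sg : bool) (p q : N) : m4 :=
  if sg then M4 p q q (N.modulo (N.mul 28 p) 29) else M4 p q (N.modulo (N.mul 28 q) 29) p.

(** Conjugation ignores scalar factors, so (p, q) runs over the projective line only. As -1 is a
    square modulo 29, some of these twists are singular and have to be skipped. *)
Definition line29 : seq (N * N) := (0%num, 1%num) :: [seq (1%num, q) | q <- field29].

Definition conj_point (sg : bool) (l V : m4) : bool :=
  if unimod4 V then
    has (fun pq : N * N => let g := twist4 sg pq.1 pq.2 in
           if N.eqb (det4 g) 0 then false else eq4 (mul4 g V) (mul4 l g)) line29
  else true.

(* The matrices V of trace -1 with tr (x V) = s have the form ((a, b), (b + s, - 1 - a)). *)
Definition conj_check (s : N) (sg : bool) (l : m4) : bool :=
  all (fun a => all (fun b => conj_point sg l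
    (M4 a b (N.modulo (N.add b s) 29) (N.modulo (N.add 28 (N.mul 28 a)) 29)))
  field29) field29.

(** 24 and 6 are the roots of t ^ 2 - t - 1 modulo 29, and the traces of x z and x z'; 5 and 23 are
    their negatives. For the latter the conjugation must send x to -x, whence the flag [true]. *)
Lemma conj_check24 : conj_check 24 false mx_z. Proof. by vm_compute. Qed.
Lemma conj_check5 : conj_check 5 true mx_z. Proof. by vm_compute. Qed.
Lemma conj_check6 : conj_check 6 false mx_z'. Proof. by vm_compute. Qed.
Lemma conj_check23 : conj_check 23 true mx_z'. Proof. by vm_compute. Qed.

Lemma companion_reduction (R : fieldType) (U V : 'M[R]_2) :
  (2%:R != 0 :> R)%R -> (\det U = 1)%R -> (\tr U = 0)%R ->
  exists g V1 : 'M[R]_2,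
  [/\ (\det g != 0)%R, (g *m U = mx2 0 1 (- 1) 0 *m g)%R, (g *m V = V1 *m g)%R,
      (\det V1 = \det V)%R & (\tr V1 = \tr V)%R /\
      (\tr (mx2 0 1 (- 1) 0 *m V1) = \tr (U *m V))%R].
Proof.
move=> two; rewrite [U]mx2_eta; set a := U _ _; set b := U _ _; set c := U _ _.
set d := U _ _; rewrite det_mx2 mxtrace_mx2 => dU /eqP; rewrite addrC addr_eq0 => /eqP ed.
rewrite ed in dU *; have [g dg gU] := involution_companion two dU.
have ug : g \in unitmx by rewrite unitmxE unitfE.
exists g, (g *m V *m invmx g)%R; split=> //.
- by rewrite mulmxKV.
- by rewrite !det_mulmx det_inv mulrAC mulfV // mul1r.
split; first by rewrite mxtrace_mulC mulKmx.
by rewrite !mulmxA -gU mxtrace_mulC !mulmxA mulVmx // mul1mx.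
Qed.

Definition trace_check : bool :=
  all (fun n => if N.eqb (N.modulo (N.mul (N.add (N.mul n n) (N.add (N.mul 28 n) 28))
                                          (N.add (N.mul n n) (N.add n 28))) 29) 0
                then [|| N.eqb n 24, N.eqb n 5, N.eqb n 6 | N.eqb n 23] else true) field29.

Lemma trace_checkT : trace_check. Proof. by vm_compute. Qed.

Lemma phi_field29 (a : F) : exists2 n : N, n \in field29 & a = phi n.
Proof. by have [n ln ->] := phi_surj a; exists (bin_of_nat n); rewrite ?map_f. Qed.

Lemma phi0 : phi 0 = 0%R. Proof. by []. Qed.
Lemma phi1 : phi 1 = 1%R. Proof. by []. Qed.

Lemma phi_eq_mod (m : N) : phi m = 0%R -> N.eqb (N.modulo m 29) 0.
Proof.
move=> e; apply/N.eqb_spec/phi_inj; rewrite ?phi_mod ?phi0 //.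
exact/N.ltb_lt/N.mod_lt.
Qed.

Lemma icosahedral_trace (t : F) :
  ((t ^+ 2 - t - 1) * (t ^+ 2 + t - 1) = 0)%R ->
  exists2 s : N, t = phi s & [|| N.eqb s 24, N.eqb s 5, N.eqb s 6 | N.eqb s 23].
Proof.
have [n ln ->] := phi_field29 t => e; exists n => //.
have := allP trace_checkT n ln; case: ifP => // /negP[]; apply: phi_eq_mod.
rewrite phiM !phiD !phiM phi28 -[RHS]e; ring.
Qed.

Lemma twist4_comm (sg : bool) (p q : N) :
  (tomx (twist4 sg p q) *m tomx mx_x = (-1) ^+ sg *: (tomx mx_x *m tomx (twist4 sg p q)))%R.
Proof.
have Z a b c d (e : F) : (e *: mx2 a b c d = mx2 (e * a) (e * b) (e * c) (e * d))%R.
  by apply/matrixP=> i j; rewrite !mxE; case: (i == 0%R); case: (j == 0%R).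
rewrite /mx_x /twist4; case: sg; rewrite /= !mx2M Z ?phi_mod ?phiM phi28 phi0 phi1 ?expr1 ?expr0;
  by congr mx2; ring.
Qed.

Lemma conj_checkP (s : N) (sg : bool) (l : m4) (V : 'M[F]_2) :
  conj_check s sg l -> (\det V = 1)%R -> (\tr V = - 1)%R ->
  (\tr (mx2 0 1 (- 1) 0 *m V) = phi s)%R ->
  exists g : 'M[F]_2, [/\ (\det g != 0)%R, (g *m V = tomx l *m g)%R &
     (g *m tomx mx_x = (-1) ^+ sg *: (tomx mx_x *m g))%R].
Proof.
rewrite [V]mx2_eta; set a := V _ _; set b := V _ _; set c := V _ _; set d := V _ _.
rewrite mx2M det_mx2 !mxtrace_mx2 => chk.
have [na la ->] := phi_field29 a; have [nb lb ->] := phi_field29 b.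
move=> dV /eqP; rewrite addrC -subr_eq0 opprK addrAC => eqd eqc.
have ed : d = phi (N.add 28 (N.mul 28 na)).
  rewrite phiD phiM phi28; apply/eqP; rewrite -subr_eq0; apply/eqP.
  by rewrite -[RHS](eqP eqd); ring.
have ec : c = phi (N.add nb s) by rewrite phiD -eqc; ring.
set W := M4 na nb (N.modulo (N.add nb s) 29) (N.modulo (N.add 28 (N.mul 28 na)) 29).
have : conj_point sg l W := allP (allP chk na la) nb lb.
have -> : mx2 (phi na) (phi nb) c d = tomx W by rewrite /W /= !phi_mod ed ec.
have uW : unimod4 W.
  apply/N.eqb_spec/phi_inj => //; first exact/N.ltb_lt/N.mod_lt.
  rewrite -det_tomx /W /= !phi_mod -ed -ec det_mx2 dV; exact/esym/phi1.
rewrite /conj_point uW => /hasP[[p q] _]; rewrite [fst _]/= [snd _]/=.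
case: ifP => // /negP dg /eq4P e.
exists (tomx (twist4 sg p q)); split; last exact: twist4_comm.
- rewrite det_tomx; apply/eqP=> /phi_eq_mod d0; apply: dg.
  by move: d0; rewrite /det4; case: (twist4 _ _ _) => ????; rewrite N.Div0.mod_mod.
- by rewrite -!tomxM e.
Qed.

(* Otherwise unification unfolds these to determinants over 'F_29 and evaluates them. *)
Local Opaque psl29 psl4.

Section MatrixTrace.
Local Open Scope ring_scope.
Variables (R : fieldType) (A : 'M[R]_2).
Hypotheses (dA : \det A = 1) (A1 : A <> 1%:M) (AN1 : A <> - 1%:M).

Lemma mxtrace_order2 : A *m A = 1%:M \/ A *m A = - 1%:M -> \tr A = 0.
Proof.
move: dA A1 AN1; rewrite [A]mx2_eta det_mx2 mxtrace_mx2.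
exact: trace_of_order2.
Qed.

Lemma mxtrace_order3 : A *m A *m A = 1%:M \/ A *m A *m A = - 1%:M -> \tr A ^+ 2 = 1.
Proof.
move: dA A1 AN1; rewrite [A]mx2_eta det_mx2 mxtrace_mx2.
exact: trace_of_order3.
Qed.

Lemma mxtrace_order5 :
  A *m A *m A *m A *m A = 1%:M \/ A *m A *m A *m A *m A = - 1%:M ->
  (\tr A ^+ 2 - \tr A - 1) * (\tr A ^+ 2 + \tr A - 1) = 0.
Proof.
move: dA A1 AN1; rewrite [A]mx2_eta det_mx2 mxtrace_mx2.
exact: trace_of_order5.
Qed.

End MatrixTrace.

Lemma tomx_mx_x : tomx mx_x = (mx2 0 1 (- 1) 0)%R.
Proof. by rewrite /= phi0 phi1 phi28. Qed.

Lemma two29 : (2%:R != 0 :> F)%R.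
Proof. by apply/eqP=> /(congr1 (@nat_of_ord _)). Qed.

(** With tr U and tr V fixed, only tr (U V) is left to distinguish pairs. It takes four values, and
    the sign of U, invisible in PSL(2,29), reduces them to the two represented by [mx_z] and
    [mx_z']. *)
Lemma icosahedral_matrices_conj (U V : 'M[F]_2) :
  (\det U = 1)%R -> (\det V = 1)%R -> (\tr U = 0)%R -> (\tr V = - 1)%R ->
  ((\tr (U *m V) ^+ 2 - \tr (U *m V) - 1) * (\tr (U *m V) ^+ 2 + \tr (U *m V) - 1) = 0)%R ->
  exists g l, [/\ (\det g != 0)%R, l = mx_z \/ l = mx_z', (g *m V = tomx l *m g)%R &
    (g *m U = tomx mx_x *m g \/ g *m U = - tomx mx_x *m g)%R].
Proof.
move=> dU dV tU tV tUV.
have [g0 [V1 [dg0 g0U g0V dV1 [tV1 tXV1]]]] := companion_reduction V two29 dU tU.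
rewrite -tXV1 in tUV; have [s es cs] := icosahedral_trace tUV.
rewrite tV in tV1; rewrite dV in dV1.
have [sg [l [hl chk]]] : exists sg l, (l = mx_z \/ l = mx_z') /\ conj_check s sg l.
  case/or4P: cs => /N.eqb_spec->.
  - by exists false, mx_z; split; [left | apply: conj_check24].
  - by exists true, mx_z; split; [left | apply: conj_check5].
  - by exists false, mx_z'; split; [right | apply: conj_check6].
  - by exists true, mx_z'; split; [right | apply: conj_check23].
have [g1 [dg1 g1V g1X]] := conj_checkP chk dV1 tV1 es.
exists (g1 *m g0)%R, l; split=> //.
- by rewrite det_mulmx mulf_neq0.
- by rewrite -[LHS]mulmxA g0V [LHS]mulmxA g1V -[LHS]mulmxA.
- have -> : ((g1 *m g0) *m U = (-1) ^+ sg *: (tomx mx_x *m (g1 *m g0)))%R.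
    by rewrite -(mulmxA g1 g0 U) g0U -tomx_mx_x (mulmxA g1 _ g0) g1X -scalemxAl -mulmxA.
  by case: (sg); [right; rewrite expr1 scaleN1r mulNmx | left; rewrite expr0 scale1r].
Qed.

Lemma psl29_neq1 (A : 'M[F]_2) : psl29 A <> 1 -> (\det A = 1)%R ->
  (A <> 1%:M)%R /\ (A <> - 1%:M)%R.
Proof.
move=> A1 dA; split=> e; apply: A1; rewrite e ?psl29N ?psl29_1 //; exact: det1.
Qed.

Lemma psl29_eq1 (A : 'M[F]_2) : (\det A = 1)%R -> psl29 A = 1 -> (A = 1%:M \/ A = - 1%:M)%R.
Proof. by move=> dA; rewrite -psl29_1; apply: psl29_eq => //; apply: det1. Qed.

Lemma psl29SM (A B : 'M[F]_2) : (\det A = 1)%R -> (\det B = 1)%R ->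
  psl29 (A *m B)%R = psl29 A * psl29 B /\ (\det (A *m B) = 1)%R.
Proof.
move=> dA dB; rewrite det_mulmx dA dB mulr1; split=> //.
by apply: psl29M; rewrite ?dA ?dB oner_eq0.
Qed.

Lemma icosahedral_pair_conj (u v : PSL2_29_carrier) :
  u \in PSL2_29 -> v \in PSL2_29 -> u <> 1 -> v <> 1 -> u * v <> 1 ->
  u ^+ 2 = 1 -> v ^+ 3 = 1 -> (u * v) ^+ 5 = 1 ->
  exists g l, [/\ (\det g != 0)%R, l = mx_z \/ l = mx_z',
    psl29 g * v = psl4 l * psl29 g & psl29 g * u = psl4 mx_x * psl29 g].
Proof.
move=> /psl29_surj[U dU ->] /psl29_surj[V0 dV0 ->] u1 v1 uv1 u2 v3 uv5.
have [eUV dUV0] := psl29SM dU dV0; rewrite -eUV in uv1 uv5.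
have [U1 UN1] := psl29_neq1 u1 dU; have [V1 VN1] := psl29_neq1 v1 dV0.
have [UV1 UVN1] := psl29_neq1 uv1 dUV0.
have tU : (\tr U = 0)%R.
  have [e2 d2] := psl29SM dU dU.
  by apply: mxtrace_order2 => //; apply: psl29_eq1; rewrite // e2.
have tV0 : (\tr V0 ^+ 2 = 1)%R.
  have [e2 d2] := psl29SM dV0 dV0; have [e3 d3] := psl29SM d2 dV0.
  by apply: mxtrace_order3 => //; apply: psl29_eq1; rewrite // e3 e2 -mulgA.
have tUV0 : ((\tr (U *m V0) ^+ 2 - \tr (U *m V0) - 1) *
             (\tr (U *m V0) ^+ 2 + \tr (U *m V0) - 1) = 0)%R.
  have [e2 d2] := psl29SM dUV0 dUV0; have [e3 d3] := psl29SM d2 dUV0.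
  have [e4 d4] := psl29SM d3 dUV0; have [e5 d5] := psl29SM d4 dUV0.
  by apply: mxtrace_order5 => //; apply: psl29_eq1; rewrite // e5 e4 e3 e2 -!mulgA.
(* The sign of the lift of v is chosen so that its trace is -1; negating V exchanges the two
   quadratic factors and keeps their product. *)
have [V [dV tV eV tUV]] : exists V : 'M[F]_2, [/\ (\det V = 1)%R, (\tr V = - 1)%R,
   psl29 V = psl29 V0 & ((\tr (U *m V) ^+ 2 - \tr (U *m V) - 1) *
             (\tr (U *m V) ^+ 2 + \tr (U *m V) - 1) = 0)%R].
  move/eqP: tV0; rewrite sqrf_eq1 => /orP[]/eqP t; last by exists V0.
  exists (- V0)%R; split.
  - by rewrite -scaleN1r detZ dV0 mulr1 sqrrN expr1n.
  - by rewrite raddfN /= t.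
  - exact: psl29N.
  - rewrite mulmxN raddfN /= -[RHS]tUV0; ring.
have [g [l [dg hl gV gU]]] := icosahedral_matrices_conj dU dV tU tV tUV.
have nz (A : 'M[F]_2) : (\det A = 1)%R -> (\det A != 0)%R by move->; apply: oner_neq0.
have dX : (\det (tomx mx_x) = 1)%R by apply: unimod4_det; vm_compute.
have dl : (\det (tomx l) = 1)%R by apply: unimod4_det; case: hl => ->; vm_compute.
exists g, l; split; [exact: dg | exact: hl | |].
  have e1 := psl29M dg (nz V dV); have e2 := psl29M (nz _ dl) dg.
  by rewrite -eV; apply: etrans (esym e1) (etrans (congr1 psl29 gV) e2).
have e1 := psl29M dg (nz U dU); apply: etrans (esym e1) _.
case: gU => gU; apply: etrans (congr1 psl29 gU) _; first exact: psl29M (nz _ dX) dg.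
have dNX : (\det (- tomx mx_x) != 0)%R.
  by rewrite -scaleN1r detZ dX mulr1 sqrrN expr1n; apply: oner_neq0.
have e2 := psl29M dNX dg; apply: (etrans e2).
apply: (congr1 (fun t => t * psl29 g)).
exact: psl29N dX.
Qed.

(** One matrix for each element of A0, with an arbitrary choice of sign. *)
Definition A5_list : seq m4 := [::
  M4 1 0 0 1; M4 0 1 28 0; M4 8 7 2 20; M4 2 20 21 22; M4 7 21 20 27;
  M4 9 7 2 21; M4 9 2 7 21; M4 2 21 20 22; M4 11 5 11 13; M4 7 20 21 27;
  M4 11 13 18 24; M4 8 2 7 20; M4 5 18 13 18; M4 11 3 27 18; M4 9 14 19 20;
  M4 13 18 24 11; M4 2 11 11 3; M4 10 9 9 14; M4 11 11 5 13; M4 3 18 18 2;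
  M4 14 20 20 10; M4 13 24 18 11; M4 5 13 18 18; M4 11 27 3 18;
  M4 9 19 14 20; M4 11 18 13 24; M4 6 22 21 24; M4 2 4 3 21; M4 7 5 6 21;
  M4 8 5 6 22; M4 3 21 27 25; M4 6 21 22 24; M4 7 6 5 21; M4 4 27 21 26;
  M4 5 22 21 23; M4 8 4 3 27; M4 5 21 22 23; M4 8 3 4 27; M4 8 6 5 22;
  M4 3 27 21 25; M4 10 24 24 20; M4 1 12 12 0; M4 4 21 27 26; M4 5 9 10 24;
  M4 12 0 28 17; M4 2 3 4 21; M4 5 10 9 24; M4 12 28 0 17; M4 3 15 9 26;
  M4 13 16 22 16; M4 9 24 24 19; M4 0 12 12 28; M4 9 26 26 14;
  M4 7 13 13 16; M4 14 3 3 9; M4 13 13 13 22; M4 3 9 15 26; M4 13 22 16 16;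
  M4 2 13 13 27; M4 13 27 27 16].

Lemma unimod4M (A B : m4) : unimod4 A -> unimod4 B -> unimod4 (mul4 A B).
Proof.
move=> uA uB; apply/N.eqb_spec/phi_inj => //.
  by apply/N.ltb_lt; case: (mul4 A B) => *; apply: N.mod_lt.
by rewrite -det_tomx tomxM det_mulmx !unimod4_det // mulr1 phi1.
Qed.

Lemma A5_list_unimod : all unimod4 A5_list. Proof. by vm_compute. Qed.

Definition A5_list_closed (g : m4) : bool :=
  all (fun l => has (eqpm4 (mul4 l g)) A5_list) A5_list.

Lemma A5_list_closed_x : A5_list_closed mx_x. Proof. by vm_compute. Qed.
Lemma A5_list_closed_z : A5_list_closed mx_z. Proof. by vm_compute. Qed.

(* Each listed matrix is an earlier one times x or z, up to sign. *)
Fixpoint tree_check (seen todo : seq m4) : bool :=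
  if todo is l :: todo' then
    (if has (fun s => if eqpm4 (mul4 s mx_x) l then true else eqpm4 (mul4 s mx_z) l) seen
     then tree_check (l :: seen) todo' else false)
  else true.

Lemma A5_list_tree : tree_check [:: one4] (behead A5_list). Proof. by vm_compute. Qed.

Definition xb := psl4 mx_x.
Definition yb := psl4 mx_y.
Definition zb := psl4 mx_z.

Definition A0 : {group PSL2_29_carrier} := <<[set xb; zb]>>%G.

Lemma unimod_x : unimod4 mx_x. Proof. by vm_compute. Qed.
Lemma unimod_y : unimod4 mx_y. Proof. by vm_compute. Qed.
Lemma unimod_z : unimod4 mx_z. Proof. by vm_compute. Qed.

Lemma xb_in : xb \in PSL2_29. Proof. exact: psl29_in (unimod4_det unimod_x). Qed.
Lemma yb_in : yb \in PSL2_29. Proof. exact: psl29_in (unimod4_det unimod_y). Qed.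
Lemma zb_in : zb \in PSL2_29. Proof. exact: psl29_in (unimod4_det unimod_z). Qed.

Lemma A0_list (u : PSL2_29_carrier) :
  u \in A0 -> exists2 l, l \in A5_list & u = psl4 l.
Proof.
move: u; apply: gen_ind; first by exists one4; rewrite ?psl4_1 // mem_head.
have step (l g : m4) : l \in A5_list -> unimod4 g -> A5_list_closed g ->
    exists2 l', l' \in A5_list & psl4 l * psl4 g = psl4 l'.
  move=> ll ug cg; have ul := allP A5_list_unimod l ll.
  have /hasP[l' ll' e] := allP cg l ll; exists l' => //.
  have e1 := psl4M ul ug.
  have e2 := psl4_eqpm (unimod4M ul ug) e.
  exact (etrans (esym e1) e2).
move=> _ a [l ll ->] /set2P[]->.
  exact: step unimod_x A5_list_closed_x.
exact: step unimod_z A5_list_closed_z.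
Qed.

Lemma list_A0 (l : m4) : l \in A5_list -> psl4 l \in A0.
Proof.
have xA : xb \in A0 by rewrite mem_gen ?set21.
have zA : zb \in A0 by rewrite mem_gen ?set22.
have tree seen todo : all unimod4 seen -> all unimod4 todo -> tree_check seen todo ->
    {in seen, forall l, psl4 l \in A0} -> {in todo, forall l, psl4 l \in A0}.
  elim: todo seen => [|m todo IH] seen us //= /andP[um ut].
  case: hasP => // -[s sseen e] tc seenA.
  have us' := allP us s sseen.
  have mA : psl4 m \in A0.
    have mm (g : m4) : unimod4 g -> psl4 g \in A0 -> eqpm4 (mul4 s g) m -> psl4 m \in A0.
      move=> ug gA em; rewrite -(psl4_eqpm (unimod4M us' ug) em) (psl4M us' ug).
      by apply: groupM; [apply: seenA | apply: gA].
    by case: ifP e => [ex _ | _ ez]; [apply: mm unimod_x xA ex | apply: mm unimod_z zA ez].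
  have seenA' : {in m :: seen, forall l, psl4 l \in A0}.
    by move=> l'; rewrite inE => /orP[/eqP->|/seenA].
  move=> l'; rewrite inE => /orP[/eqP-> // |].
  by apply: (IH (m :: seen)) => //=; rewrite um.
rewrite -[A5_list]/(one4 :: behead A5_list) inE => /orP[/eqP->|].
  by rewrite psl4_1 group1.
have us : all unimod4 [:: one4] by vm_compute.
have ut : all unimod4 (behead A5_list) by vm_compute.
apply: (tree _ _ us ut A5_list_tree) => l'.
by rewrite inE => /eqP->; rewrite psl4_1 group1.
Qed.

(** Closure of the list under right multiplication by the generators gives this bound; the opposite
    one comes from any A5 found inside a conjugate of A0. *)
Lemma card_A0 : #|A0| <= 60.
Proof.
have sA : {subset A0 <= map psl4 A5_list}.
  by move=> u /A0_list[l ll ->]; apply: map_f.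
by apply: leq_trans (subset_leq_card (introT subsetP sA)) (card_size _).
Qed.

(** * Explicit permutations as products of transpositions *)

Definition swapn (i : nat) (p : nat * nat) : nat :=
  if eqn i p.1 then p.2 else if eqn i p.2 then p.1 else i.

Definition swaps n (l : seq (nat * nat)) : {perm 'I_n.+1} :=
  \prod_(p <- l) tperm (inord p.1) (inord p.2).

Definition swaps_in (n : nat) (l : seq (nat * nat)) : bool :=
  all (fun p => [&& leq p.1 n, leq p.2 n & ~~ eqn p.1 p.2]) l.

(** Reduces every fact about a concrete permutation to a fold over natural numbers, which
    evaluates. *)
Lemma swaps_val n (l : seq (nat * nat)) (i : 'I_n.+1) :
  swaps_in n l -> swaps n l i = foldl swapn i l :> nat.
Proof.
elim: l i => [|[a b] l IH] i; first by rewrite /swaps big_nil perm1.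
move=> /= /andP[/and3P[la lb _] hl].
rewrite /swaps big_cons permM IH //; congr foldl; rewrite /swapn /=.
case: tpermP => [->|->|/eqP na /eqP nb]; rewrite ?inordK ?ltnS ?eqnE ?eqxx //.
  by case: eqP => // ->.
by move: na nb; rewrite -!val_eqE /= !inordK ?ltnS // => /negPf-> /negPf->.
Qed.

Definition swaps_fix (n : nat) (l : seq (nat * nat)) : bool :=
  all (fun i => eqn (foldl swapn i l) i) (iota 0 n.+1).

Lemma swaps_eq1 n (l : seq (nat * nat)) : swaps_in n l -> swaps_fix n l -> swaps n l = 1.
Proof.
move=> il /allP fl; apply/permP=> i; apply/val_inj; rewrite perm1 /= swaps_val //.
by apply/eqP; rewrite -eqnE; apply: fl; rewrite mem_iota /= add0n.
Qed.

Lemma swaps_neq1 n (l : seq (nat * nat)) : swaps_in n l -> ~~ swaps_fix n l -> swaps n l <> 1.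
Proof.
move=> il /allPn[i]; rewrite mem_iota add0n => /= li /eqP nfix e; apply: nfix.
by rewrite -(swaps_val (Ordinal li) il) e perm1.
Qed.

Lemma swaps_cat n (l1 l2 : seq (nat * nat)) : swaps n (l1 ++ l2) = swaps n l1 * swaps n l2.
Proof. by rewrite /swaps big_cat. Qed.

Lemma swaps_even n (l : seq (nat * nat)) :
  swaps_in n l -> ~~ odd (size l) -> swaps n l \in 'Alt_('I_n.+1).
Proof.
move=> il ol; rewrite Alt_even; suff -> : odd_perm (swaps n l) = odd (size l) by [].
elim: l il {ol} => [|[a b] l IH] /=; first by rewrite /swaps big_nil odd_perm1.
move=> /andP[/and3P[la lb nab] hl]; rewrite /swaps big_cons odd_permM -/(swaps n l) IH //.
by rewrite odd_tperm -val_eqE /= !inordK ?ltnS // -eqnE nab.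
Qed.

Lemma order_prime_perm (gT : finGroupType) (p : nat) (u : gT) :
  prime p -> u ^+ p = 1 -> u <> 1 -> #[u] = p.
Proof. by move=> pp up /eqP u1; apply: nt_prime_order. Qed.

(** The index of H divides 2, and a subgroup of index 2 would be normal, hence trivial by
    simplicity, against 1 < m. *)
Lemma simple_large_subgroup (gT : finGroupType) (G H : {group gT}) (m : nat) :
  simple G -> H \subset G -> #|G| = m.*2 -> 1 < m -> m %| #|H| -> H :=: G.
Proof.
move=> simG sHG cG m1 /dvdnP[k ek].
have := Lagrange sHG; rewrite cG ek -mul2n -mulnA [(m * _)%N]mulnC mulnA => /eqP.
rewrite eqn_pmul2r ?(ltnW m1) // => /eqP ei.
have i12 : #|G : H| = 1%N \/ #|G : H| = 2.
  have : #|G : H| %| 2 by rewrite -ei dvdn_mull.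
  by rewrite dvdn_divisors // !inE => /orP[]/eqP; [left|right].
case: i12 => [/eqP|/(index2_normal sHG) nHG].
  by rewrite indexg_eq1 => sGH; apply/eqP; rewrite eqEsubset sHG.
have [_ /(_ H nHG)[H1|//]] := simpleP _ simG.
by move: ek m1; rewrite H1 cards1 => /eqP; rewrite eq_sym muln_eq1 => /andP[_ /eqP->].
Qed.

Lemma A5_conj (G : {group PSL2_29_carrier}) :
  G \subset PSL2_29 -> G \isog 'Alt_('I_5) ->
  exists2 h, h \in 'N(PSL2_29) & G :=: A0 :^ h.
Proof.
move=> sG isoG; have cAlt : #|'Alt_('I_5)| = 60.
  by apply: double_inj; rewrite -mul2n card_Alt card_ord.
have cG : #|G| = 60 by rewrite (card_isog isoG) cAlt.
have simG : simple G by rewrite (isog_simple isoG) simple_Alt5 // card_ord.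
have /isogP[f injf imf] : 'Alt_('I_5) \isog G by rewrite isog_sym.
(* An involution and a 3-cycle of A5 whose product is a 5-cycle: the (2, 3, 5) marking whose
   matrices the trace argument classifies. *)
pose la : seq (nat * nat) := [:: (0, 1); (2, 3)]%N.
pose lb : seq (nat * nat) := [:: (0, 2); (0, 4)]%N.
pose a := swaps 4 la; pose b := swaps 4 lb.
have aA : a \in 'Alt_('I_5) by apply: swaps_even.
have bA : b \in 'Alt_('I_5) by apply: swaps_even.
have a2 : a ^+ 2 = 1 by rewrite expgS expg1 -swaps_cat; apply: swaps_eq1; vm_compute.
have b3 : b ^+ 3 = 1 by rewrite !expgS expg0 mulg1 -!swaps_cat; apply: swaps_eq1; vm_compute.
have ab5 : (a * b) ^+ 5 = 1.
  by rewrite !expgS expg0 mulg1 -!swaps_cat; apply: swaps_eq1; vm_compute.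
have a1 : a <> 1 by apply: swaps_neq1; vm_compute.
have b1 : b <> 1 by apply: swaps_neq1; vm_compute.
have ab1 : a * b <> 1 by rewrite -swaps_cat; apply: swaps_neq1; vm_compute.
have f1 c : c \in 'Alt_('I_5) -> c <> 1 -> f c <> 1.
  by move=> cA c1 /eqP; rewrite morph_injm_eq1 // => /eqP.
pose u := f a; pose v := f b.
have uG : u \in G by rewrite -imf mem_morphim.
have vG : v \in G by rewrite -imf mem_morphim.
have uv : u * v = f (a * b) by rewrite morphM.
have u1 := f1 _ aA a1; have v1 := f1 _ bA b1.
have uv1 : u * v <> 1 by rewrite uv; apply: f1 => //; apply: groupM.
have u2 : u ^+ 2 = 1 by rewrite -morphX // a2 morph1.
have v3 : v ^+ 3 = 1 by rewrite -morphX // b3 morph1.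
have uv5 : (u * v) ^+ 5 = 1 by rewrite uv -morphX ?groupM // ab5 morph1.
have genG : <<[set u; v]>> = G.
  pose H := <<[set u; v]>>%G; have uH : u \in H by rewrite mem_gen ?set21.
  have vH : v \in H by rewrite mem_gen ?set22.
  (* Elements of orders 2, 3 and 5 make 30, half the order of G, divide the order of H. *)
  apply: (@simple_large_subgroup _ G H 30) => //.
    by rewrite gen_subG; apply/subsetP=> c /set2P[]->.
  rewrite (@Gauss_dvd 6 5) // (@Gauss_dvd 2 3) //.
  rewrite -{1}(order_prime_perm (isT : prime 2) u2 u1) order_dvdG //.
  rewrite -{1}(order_prime_perm (isT : prime 3) v3 v1) order_dvdG //.
  by rewrite -{1}(order_prime_perm (isT : prime 5) uv5 uv1) order_dvdG ?groupM.
have [g [l [dg hl gv gu]]] := icosahedral_pair_conj (subsetP sG u uG) (subsetP sG v vG)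
  u1 v1 uv1 u2 v3 uv5.
exists (psl29 g); first exact: psl29_norm.
(* Since z' lies in A0 as well, both values of the trace lead into the same subgroup; this is why
   the A5 subgroups form one orbit under GL(2,29). *)
have lA : psl4 l \in A0.
  apply: list_A0; case: hl => ->; vm_compute; reflexivity.
have conj w w' : psl29 g * w = w' * psl29 g -> w = w' ^ psl29 g.
  by move=> e; rewrite /conjg -e mulKg.
apply/eqP; rewrite eqEcard cardJg cG card_A0 andbT -genG gen_subG.
apply/subsetP=> c /set2P[]->.
  by rewrite (conj _ _ gu) memJ_conjg mem_gen ?set21.
by rewrite (conj _ _ gv) memJ_conjg.
Qed.

(* Representatives of the right cosets of A0, ordered by a breadth-first search. *)
Definition coset_reps : seq m4 := [::
  M4 1 0 0 1; M4 1 7 8 28; M4 7 28 28 21; M4 4 0 24 22; M4 0 4 7 24;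
  M4 4 28 26 1; M4 3 25 25 25; M4 8 22 17 7; M4 1 4 28 26; M4 4 3 4 25;
  M4 13 1 11 21; M4 7 8 22 17; M4 10 5 15 25; M4 8 26 24 2; M4 13 0 14 9;
  M4 9 1 24 6; M4 1 16 21 18; M4 5 19 25 14; M4 3 8 27 24; M4 0 13 20 14;
  M4 13 4 28 2; M4 1 20 6 5; M4 13 20 20 13; M4 11 8 1 14; M4 9 20 4 9;
  M4 9 13 16 20; M4 11 7 3 2; M4 12 13 13 19; M4 3 1 15 15; M4 4 16 2 1;
  M4 10 28 0 3; M4 1 2 17 6; M4 8 18 14 28; M4 12 18 3 7; M4 12 24 22 3;
  M4 9 9 20 4; M4 5 15 11 10; M4 4 1 8 24; M4 11 4 23 19; M4 7 18 2 26;
  M4 9 12 19 19; M4 14 15 1 26; M4 13 17 19 16; M4 6 25 26 7;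
  M4 11 20 19 3; M4 3 17 24 1; M4 1 10 26 0; M4 2 28 6 12; M4 7 9 6 12;
  M4 13 10 23 20; M4 11 12 22 3; M4 5 12 26 22; M4 6 4 6 9; M4 3 11 23 17;
  M4 14 5 19 11; M4 1 25 24 21; M4 4 18 19 6; M4 6 2 7 17; M4 5 3 10 12;
  M4 12 20 19 10; M4 7 4 19 11; M4 4 6 22 26; M4 9 11 26 19; M4 6 3 3 21;
  M4 6 14 14 28; M4 14 23 14 21; M4 9 22 12 23; M4 13 3 15 8; M4 6 23 9 25;
  M4 8 1 21 10; M4 4 2 21 18; M4 14 23 28 15; M4 6 14 20 13; M4 4 23 9 23;
  M4 2 23 21 10; M4 11 26 17 6; M4 4 10 14 28; M4 12 20 14 21; M4 6 24 0 5;
  M4 2 18 11 27; M4 0 14 2 8; M4 10 11 19 21; M4 2 23 17 22; M4 6 5 26 17;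
  M4 0 3 19 0; M4 12 21 12 9; M4 9 9 2 15; M4 6 7 2 17; M4 7 22 14 11;
  M4 4 14 21 23; M4 11 26 6 9; M4 5 12 21 10; M4 13 7 9 25; M4 0 10 26 22;
  M4 3 16 8 14; M4 1 21 10 8; M4 2 25 18 8; M4 9 3 9 16; M4 7 10 1 14;
  M4 13 7 22 3; M4 14 23 13 9; M4 2 28 8 11; M4 6 2 19 21; M4 10 25 28 15;
  M4 9 12 8 14; M4 5 6 24 0; M4 5 11 18 5; M4 14 0 8 27; M4 11 19 21 10;
  M4 11 1 13 25; M4 14 0 9 27; M4 4 10 6 8; M4 5 23 17 3; M4 8 12 20 12;
  M4 9 20 15 27; M4 6 4 23 1; M4 3 11 17 24; M4 7 7 18 14; M4 14 25 23 8;
  M4 3 11 20 6; M4 12 24 10 8; M4 10 0 22 3; M4 14 24 25 16; M4 2 7 24 12;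
  M4 5 14 13 25; M4 8 8 20 2; M4 10 22 14 28; M4 7 16 3 7; M4 5 12 2 5;
  M4 13 7 6 10; M4 1 2 18 8; M4 7 18 16 4; M4 14 19 22 3; M4 11 7 25 16;
  M4 9 13 5 17; M4 6 19 11 6; M4 14 11 21 0; M4 4 18 27 13; M4 11 0 15 8;
  M4 0 14 2 9; M4 10 25 8 23; M4 14 17 17 0; M4 1 27 3 24; M4 12 14 0 17;
  M4 4 1 0 22; M4 5 13 14 25; M4 12 15 27 0; M4 11 15 0 8; M4 12 11 3 27;
  M4 12 20 2 1; M4 10 12 17 6; M4 7 17 21 18; M4 14 2 0 27; M4 0 7 4 11;
  M4 1 9 13 2; M4 10 25 9 11; M4 14 19 7 22; M4 7 16 10 23; M4 12 19 6 12;
  M4 8 17 23 20; M4 6 14 26 27; M4 11 26 28 3; M4 2 28 10 10; M4 5 3 20 18;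
  M4 14 15 0 27; M4 11 4 16 27; M4 10 6 23 11; M4 13 23 1 13; M4 11 1 6 27;
  M4 3 10 15 2; M4 1 19 20 4; M4 4 14 13 24; M4 1 10 24 9; M4 2 1 5 3;
  M4 1 25 22 0; M4 8 5 17 18; M4 13 18 2 14; M4 10 7 13 15; M4 2 0 16 15;
  M4 11 17 27 26; M4 13 15 16 23; M4 2 14 20 10; M4 9 12 28 2;
  M4 12 9 26 22; M4 2 26 9 16; M4 2 15 27 0; M4 7 0 11 25; M4 12 8 9 23;
  M4 3 24 18 9; M4 14 14 2 0; M4 10 26 2 14; M4 2 18 7 20; M4 10 28 9 5;
  M4 6 3 20 15; M4 6 11 7 13; M4 9 17 22 3; M4 3 2 13 9; M4 9 8 5 11;
  M4 12 1 24 19; M4 1 26 23 19; M4 1 17 19 5; M4 13 28 17 1; M4 1 13 28 17].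

(** * The action on 203 blocks of 6 points *)

Section Blocks.
Local Open Scope nat_scope.

(* The entry (j, [:: t1; ...; tk]) at position i means that the generator maps the block i to the
   block j, acting on the points by the transpositions t1, then t2, and so on. *)
Definition wreath_x : seq (nat * seq (nat * nat)) := [::
  (0,[::(2,4);(3,5)]); (2,[::]); (1,[::]); (4,[::]); (3,[::]); (8,[::]);
  (9,[::]); (11,[::]); (5,[::]); (6,[::]); (16,[::]); (7,[::]); (17,[::]);
  (18,[::]); (19,[::]); (21,[::]); (10,[::]); (12,[::]); (13,[::]);
  (14,[::]); (29,[::]); (15,[::]); (25,[::]); (32,[::]); (35,[::]);
  (22,[::]); (39,[::]); (42,[::]); (41,[::(2,4);(3,5)]); (20,[::]);
  (46,[::]); (47,[::]); (23,[::]); (50,[::]); (51,[::]); (24,[::]);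
  (54,[::]); (55,[::]); (56,[::]); (26,[::]); (59,[::]);
  (28,[::(2,4);(3,5)]); (27,[::]); (61,[::]); (62,[::]);
  (58,[::(1,4);(1,2);(1,5);(1,3)]); (30,[::]); (31,[::]); (66,[::]);
  (60,[::(1,4);(3,5)]); (33,[::]); (34,[::]); (73,[::]); (75,[::]);
  (36,[::]); (37,[::]); (38,[::]); (82,[::]);
  (45,[::(1,3);(1,5);(1,2);(1,4)]); (40,[::]); (49,[::(1,4);(3,5)]);
  (43,[::]); (44,[::]); (79,[::(1,4);(1,2);(1,5);(1,3)]); (71,[::]);
  (65,[::(2,4);(3,5)]); (48,[::]); (94,[::]); (68,[::(1,4);(3,5)]);
  (95,[::]); (96,[::]); (64,[::]); (100,[::]); (52,[::]); (102,[::]);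
  (53,[::]); (103,[::]); (104,[::]); (105,[::]);
  (63,[::(1,3);(1,5);(1,2);(1,4)]); (107,[::]); (108,[::]); (57,[::]);
  (112,[::]); (87,[::(1,3);(1,5);(1,2);(1,4)]); (113,[::]); (114,[::]);
  (84,[::(1,4);(1,2);(1,5);(1,3)]); (117,[::]); (118,[::]); (119,[::]);
  (120,[::]); (116,[::(2,4);(3,5)]); (121,[::]); (67,[::]); (69,[::]);
  (70,[::]); (115,[::(0,4);(0,2);(1,5);(1,3)]); (126,[::]); (127,[::]);
  (72,[::]); (130,[::]); (74,[::]); (76,[::]); (77,[::]); (78,[::]);
  (106,[::(1,3);(4,5)]); (80,[::]); (81,[::]); (125,[::(1,4);(1,2)]);
  (139,[::]); (140,[::]); (83,[::]); (85,[::]); (86,[::]);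
  (97,[::(0,2);(0,4);(1,3);(1,5)]); (92,[::(2,4);(3,5)]); (88,[::]);
  (89,[::]); (90,[::]); (91,[::]); (93,[::]); (124,[::]);
  (132,[::(0,2);(1,5)]); (122,[::]); (109,[::(1,2);(1,4)]); (98,[::]);
  (99,[::]); (134,[::(0,5);(0,4);(1,2);(1,3)]); (157,[::]); (101,[::]);
  (133,[::]); (123,[::(0,2);(1,5)]); (131,[::]);
  (128,[::(0,4);(0,5);(1,3);(1,2)]); (166,[::]); (147,[::]); (165,[::]);
  (156,[::(1,4);(1,2)]); (110,[::]); (111,[::]); (143,[::]); (173,[::]);
  (141,[::]); (174,[::]); (171,[::(2,4);(3,5)]);
  (167,[::(1,2);(1,4);(1,5);(1,3)]); (136,[::]); (179,[::]); (182,[::]);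
  (158,[::]); (154,[::(1,4);(3,5)]); (185,[::]); (186,[::]);
  (151,[::(1,4);(3,5)]); (175,[::(0,3);(0,4);(1,2);(1,5)]);
  (138,[::(1,2);(1,4)]); (129,[::]); (150,[::]); (187,[::]);
  (162,[::(0,5);(0,4);(1,2);(1,3)]); (177,[::(0,3);(0,4);(1,2);(1,5)]);
  (160,[::(0,4);(0,5);(1,3);(1,2)]); (188,[::]); (189,[::]); (137,[::]);
  (135,[::]); (146,[::(1,3);(1,5);(1,4);(1,2)]); (176,[::(1,2);(1,4)]);
  (190,[::]); (178,[::(0,4);(0,5);(0,3);(0,2)]); (145,[::(2,4);(3,5)]);
  (192,[::]); (142,[::]); (144,[::]); (155,[::(0,4);(0,3);(1,5);(1,2)]);
  (168,[::(1,4);(1,2)]); (161,[::(0,4);(0,3);(1,5);(1,2)]);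
  (170,[::(0,2);(0,3);(0,5);(0,4)]); (148,[::]);
  (193,[::(0,4);(0,5);(0,3);(0,1)]); (194,[::(1,3);(1,5);(1,2);(1,4)]);
  (149,[::]); (195,[::]); (196,[::]); (152,[::]); (153,[::]); (159,[::]);
  (163,[::]); (164,[::]); (169,[::]); (191,[::(0,4);(1,5)]); (172,[::]);
  (180,[::(0,1);(0,3);(0,5);(0,4)]); (181,[::(1,4);(1,2);(1,5);(1,3)]);
  (183,[::]); (184,[::]); (197,[::(2,4);(3,5)]); (200,[::]);
  (199,[::(0,5);(1,2)]); (198,[::]); (202,[::]); (201,[::])].

Definition wreath_y : seq (nat * seq (nat * nat)) := [::
  (1,[::]); (0,[::]); (2,[::(2,4);(3,5)]); (5,[::]); (6,[::]); (3,[::]);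
  (4,[::]); (12,[::]); (9,[::]); (8,[::]); (13,[::]);
  (15,[::(1,3);(1,5);(1,2);(1,4)]); (7,[::]); (10,[::]); (20,[::]);
  (11,[::(1,4);(1,2);(1,5);(1,3)]); (22,[::]);
  (21,[::(1,3);(1,5);(1,2);(1,4)]); (25,[::]); (27,[::]); (14,[::]);
  (17,[::(1,4);(1,2);(1,5);(1,3)]); (16,[::]); (33,[::]); (36,[::]);
  (18,[::]); (40,[::]); (19,[::]); (44,[::]); (42,[::]);
  (37,[::(1,4);(1,2);(1,5);(1,3)]); (34,[::]); (48,[::]); (23,[::]);
  (31,[::]); (52,[::]); (24,[::]); (30,[::(1,3);(1,5);(1,2);(1,4)]);
  (41,[::]); (57,[::]); (26,[::]); (38,[::]); (29,[::]); (45,[::]);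
  (28,[::]); (43,[::]); (63,[::]); (64,[::]); (32,[::]); (68,[::]);
  (66,[::]); (71,[::]); (35,[::]); (76,[::]); (73,[::]); (79,[::]);
  (62,[::(2,4);(3,5)]); (39,[::]); (84,[::]); (82,[::]);
  (60,[::(1,4);(3,5)]); (87,[::]); (56,[::(2,4);(3,5)]); (46,[::]);
  (47,[::]); (91,[::]); (50,[::]); (69,[::]); (49,[::]); (67,[::]);
  (97,[::]); (51,[::]); (101,[::]); (54,[::]); (77,[::]); (99,[::]);
  (53,[::]); (74,[::]); (106,[::]); (55,[::]); (89,[::]); (109,[::]);
  (59,[::]); (85,[::]); (58,[::]); (83,[::]); (115,[::]); (61,[::]);
  (110,[::(2,4);(3,5)]); (80,[::]); (92,[::]); (65,[::]); (90,[::]);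
  (98,[::]); (122,[::]); (124,[::]); (114,[::(0,4);(0,2);(1,5);(1,3)]);
  (70,[::]); (93,[::]); (75,[::]); (128,[::]); (72,[::]); (131,[::]);
  (127,[::]); (133,[::]); (105,[::(1,3);(4,5)]); (78,[::]); (136,[::]);
  (138,[::]); (81,[::]); (88,[::(2,4);(3,5)]); (116,[::]); (141,[::]);
  (143,[::]); (96,[::(0,2);(0,4);(1,3);(1,5)]); (86,[::]); (111,[::]);
  (145,[::]); (147,[::]); (140,[::(2,4);(3,5)]); (120,[::(2,4);(3,5)]);
  (150,[::]); (94,[::]); (153,[::]); (95,[::]); (156,[::]); (158,[::]);
  (103,[::]); (100,[::]); (161,[::]); (134,[::(0,5);(0,4);(1,2);(1,3)]);
  (102,[::]); (149,[::(1,5);(1,3)]); (104,[::]);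
  (130,[::(0,4);(0,5);(1,3);(1,2)]); (167,[::]); (107,[::]); (169,[::]);
  (108,[::]); (171,[::]); (119,[::(2,4);(3,5)]); (112,[::]);
  (163,[::(2,5);(2,4)]); (113,[::]); (144,[::(0,4);(1,5)]); (117,[::]);
  (176,[::]); (118,[::]); (180,[::]); (132,[::(1,3);(1,5)]); (121,[::]);
  (184,[::]); (154,[::]); (123,[::]); (152,[::]); (157,[::]); (125,[::]);
  (155,[::]); (126,[::]); (170,[::]); (162,[::]); (129,[::]); (160,[::]);
  (142,[::(2,4);(2,5)]); (165,[::]); (164,[::]);
  (168,[::(1,3);(1,5);(1,2);(1,4)]); (135,[::]);
  (166,[::(1,4);(1,2);(1,5);(1,3)]); (137,[::]); (159,[::]); (139,[::]);
  (193,[::]); (183,[::(0,2);(0,4);(1,3);(1,5)]); (191,[::]); (177,[::]);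
  (146,[::]); (175,[::]); (181,[::]); (192,[::(0,4);(0,5);(0,3);(0,1)]);
  (148,[::]); (178,[::]); (186,[::(0,2);(1,3)]);
  (173,[::(0,4);(0,2);(1,5);(1,3)]); (151,[::]); (196,[::(1,4);(3,5)]);
  (182,[::(0,2);(1,3)]); (194,[::(0,1);(0,3);(0,4);(0,2)]);
  (195,[::(0,2);(1,3);(1,5);(1,4)]); (190,[::]); (189,[::]); (174,[::]);
  (179,[::(0,1);(0,3);(0,5);(0,4)]); (172,[::]);
  (187,[::(0,2);(0,4);(0,3);(0,1)]); (188,[::(0,2);(1,4);(1,5);(1,3)]);
  (185,[::(1,4);(3,5)]); (198,[::(0,1);(0,3);(0,5);(0,4)]);
  (197,[::(0,4);(0,5);(0,3);(0,1)]); (199,[::(2,4);(3,5)]);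
  (200,[::(0,2);(4,5)]); (202,[::(0,4);(0,2);(1,3);(1,5)]);
  (201,[::(0,2);(0,4);(1,5);(1,3)])].

Definition wreath_z : seq (nat * seq (nat * nat)) := [::
  (0,[::(1,5);(1,4)]); (1,[::(1,4);(1,5)]); (3,[::]); (5,[::(2,4);(3,5)]);
  (7,[::]); (2,[::(2,4);(3,5)]); (10,[::]); (13,[::]); (14,[::]);
  (15,[::]); (12,[::]); (8,[::(1,3);(1,5);(1,2);(1,4)]); (6,[::]);
  (4,[::]); (11,[::(1,4);(1,2);(1,5);(1,3)]); (20,[::]); (23,[::]);
  (24,[::]); (26,[::]); (28,[::]); (9,[::]); (30,[::]); (31,[::]);
  (34,[::]); (37,[::]); (38,[::]); (41,[::]); (43,[::]); (45,[::]);
  (42,[::(1,4);(3,5)]); (36,[::(1,4);(1,2);(1,5);(1,3)]); (33,[::]);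
  (49,[::]); (22,[::]); (16,[::]); (53,[::]);
  (21,[::(1,3);(1,5);(1,2);(1,4)]); (17,[::]); (40,[::]); (58,[::]);
  (25,[::]); (18,[::]); (60,[::]); (44,[::]); (27,[::]); (19,[::]);
  (55,[::]); (65,[::]); (67,[::]); (69,[::]); (70,[::]); (72,[::]);
  (74,[::]); (77,[::]); (78,[::]); (80,[::]); (81,[::]); (83,[::]);
  (85,[::]); (86,[::]); (29,[::(1,4);(3,5)]); (54,[::(1,2);(1,5)]);
  (88,[::]); (89,[::]); (90,[::]); (92,[::]); (93,[::]); (68,[::]);
  (48,[::]); (32,[::]); (98,[::]); (99,[::]); (75,[::]);
  (87,[::(1,5);(1,2)]); (76,[::]); (51,[::]); (52,[::]); (35,[::]);
  (61,[::(1,5);(1,2)]); (63,[::]); (46,[::]); (110,[::]); (111,[::]);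
  (84,[::]); (57,[::]); (39,[::]); (116,[::]); (106,[::(1,2);(1,5)]);
  (109,[::(2,4);(3,5)]); (79,[::]); (91,[::]); (64,[::]); (47,[::]);
  (97,[::]); (123,[::]); (125,[::]); (114,[::(2,4);(3,5)]); (66,[::]);
  (50,[::]); (101,[::]); (129,[::]); (71,[::]); (112,[::(2,4);(2,5)]);
  (132,[::]); (134,[::]); (135,[::]); (73,[::]); (137,[::]); (126,[::]);
  (62,[::(2,4);(3,5)]); (56,[::]); (115,[::]); (142,[::]);
  (113,[::(1,5);(1,4)]); (144,[::]); (82,[::]); (59,[::]); (146,[::]);
  (148,[::]); (149,[::]); (120,[::(1,3);(1,5)]); (151,[::]); (152,[::]);
  (154,[::]); (155,[::]); (157,[::]); (159,[::]); (119,[::(1,5);(1,3)]);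
  (160,[::]); (162,[::]); (133,[::(0,5);(0,4);(1,2);(1,3)]); (163,[::]);
  (140,[::(1,3);(2,4)]); (164,[::]); (165,[::]); (167,[::(1,3);(4,5)]);
  (168,[::]); (166,[::(1,4);(1,2);(1,5);(1,3)]); (170,[::]); (172,[::]);
  (103,[::(1,3);(2,4)]); (131,[::(2,5);(2,4)]); (102,[::(2,5);(2,4)]);
  (143,[::(1,4);(1,5)]); (96,[::(2,4);(3,5)]); (175,[::]); (177,[::]);
  (178,[::]); (181,[::]); (127,[::(1,3);(1,5)]); (183,[::]);
  (173,[::(0,4);(0,2);(1,5);(1,3)]); (153,[::]); (122,[::]); (94,[::]);
  (156,[::]); (124,[::]); (95,[::]); (138,[::]); (108,[::]); (161,[::]);
  (128,[::]); (100,[::]); (141,[::(2,4);(2,5)]);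
  (130,[::(0,4);(0,5);(1,3);(1,2)]); (104,[::]);
  (107,[::(1,3);(1,5);(1,2);(1,4)]); (105,[::(1,3);(4,5)]); (169,[::]);
  (136,[::]); (158,[::]); (191,[::]); (174,[::]);
  (121,[::(0,2);(0,4);(1,3);(1,5)]); (139,[::]); (176,[::]); (145,[::]);
  (117,[::]); (180,[::]); (194,[::]); (147,[::]); (118,[::]);
  (189,[::(0,5);(0,4);(1,2);(1,3)]); (184,[::]); (150,[::]);
  (196,[::(1,2);(1,4)]); (195,[::(0,5);(2,4)]); (192,[::(2,4);(3,5)]);
  (182,[::(0,4);(0,3);(0,2);(0,5)]); (188,[::(1,4);(1,2)]);
  (186,[::(0,4);(0,5);(0,2);(0,3)]); (193,[::]); (197,[::]); (171,[::]);
  (198,[::]); (190,[::(0,4);(0,5);(0,3);(0,2)]); (199,[::]);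
  (187,[::(2,4);(3,5)]); (179,[::]); (185,[::(1,4);(1,2)]); (201,[::]);
  (202,[::(1,3);(1,5);(1,2);(1,4)]); (200,[::(1,4);(1,2);(1,5);(1,3)])].

Definition wreath_entry (T : seq (nat * seq (nat * nat))) (i : nat) :=
  nth (0, [::]) T i.

Definition wreath_wf (T : seq (nat * seq (nat * nat))) : bool :=
  all (fun e => [&& leq e.1 202, swaps_in 5 e.2 & ~~ odd (size e.2)]) T.

Definition block_point := ('I_203 * 'I_6)%type.

Definition wreath_fun T (p : block_point) : block_point :=
  (inord (wreath_entry T p.1).1, swaps 5 (wreath_entry T p.1).2 p.2).

(* The entry (j, s) at position i sends the block i to the block j and its point a to nth 0 s a. *)
Definition array := seq (nat * seq nat).
Definition entry (A : array) (i : nat) := nth (0, [::]) A i.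

Definition array_of (T : seq (nat * seq (nat * nat))) : array :=
  [seq (e.1, [seq foldl swapn a e.2 | a <- iota 0 6]) | e <- T].

Definition array_mul (A B : array) : array :=
  [seq (let b := entry B e.1 in (b.1, [seq nth 0 b.2 a | a <- e.2])) | e <- A].

Definition array_one : array := [seq (i, iota 0 6) | i <- iota 0 203].

Fixpoint array_exp (A : array) (n : nat) : array :=
  if n is m.+1 then array_mul A (array_exp A m) else array_one.

(** Turns an equality of permutations of 1218 points into an equality of two evaluated lists. *)
Definition represents (f : block_point -> block_point) (A : array) : Prop :=
  size A = 203 /\ forall (i : 'I_203) (a : 'I_6),
  [/\ (f (i, a)).1 = (entry A i).1 :> nat, (f (i, a)).2 = nth 0 (entry A i).2 a :> nat
    & size (entry A i).2 = 6].

Lemma represents_mul f g A B :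
  represents f A -> represents g B -> represents (g \o f) (array_mul A B).
Proof.
move=> [sA hA] [sB hB]; split=> [|i a]; first by rewrite size_map.
have [] := hA i a; rewrite [(g \o f) _]/=; case: (f (i, a)) => j b /= f1 f2 sz.
have [g1 g2 sz'] := hB j b.
have -> : entry (array_mul A B) i = ((entry B j).1, [seq nth 0 (entry B j).2 c | c <- (entry A i).2]).
  by rewrite /entry (nth_map (0, [::])) ?sA // -/(entry A i) -f1.
by rewrite /= size_map (nth_map 0) ?sz // -f2 g1 g2.
Qed.

Lemma represents_one : represents id array_one.
Proof.
split=> [|i a]; first by rewrite size_map size_iota.
rewrite /entry (nth_map 0) ?size_iota // nth_iota // add0n /=.
by split=> //; case: a => [[|[|[|[|[|[|]]]]]]].
Qed.

Lemma represents_eq f g A B : represents f A -> represents g B -> A = B -> f =1 g.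
Proof.
move=> [_ hA] [_ hB] eAB [i a]; have [f1 f2 _] := hA i a; have [g1 g2 _] := hB i a.
rewrite [f _]surjective_pairing [g _]surjective_pairing.
by congr pair; apply/val_inj; rewrite /= ?f1 ?f2 ?g1 ?g2 eAB.
Qed.

Lemma represents_wreath T : size T = 203 -> wreath_wf T -> represents (wreath_fun T) (array_of T).
Proof.
move=> sT /all_nthP wf; split=> [|i a]; first by rewrite size_map.
have /and3P[l1 l2 _] : [&& leq (wreath_entry T i).1 202, swaps_in 5 (wreath_entry T i).2
    & ~~ odd (size (wreath_entry T i).2)] by apply: wf; rewrite sT.
have -> : entry (array_of T) i = ((wreath_entry T i).1,
    [seq foldl swapn a (wreath_entry T i).2 | a <- iota 0 6]).
  by rewrite /entry (nth_map (0, [::])) ?sT.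
split; rewrite /= ?inordK ?swaps_val //.
by case: a => [[|[|[|[|[|[|]]]]]]].
Qed.

End Blocks.

Definition tables_wf : bool := [&& wreath_wf wreath_x, wreath_wf wreath_y & wreath_wf wreath_z].
Lemma tables_wfT : tables_wf. Proof. by vm_compute. Qed.
Lemma wreath_x_wf : wreath_wf wreath_x. Proof. by have /and3P[] := tables_wfT. Qed.
Lemma wreath_y_wf : wreath_wf wreath_y. Proof. by have /and3P[] := tables_wfT. Qed.
Lemma wreath_z_wf : wreath_wf wreath_z. Proof. by have /and3P[] := tables_wfT. Qed.

Definition array_x := array_of wreath_x.
Definition array_y := array_of wreath_y.
Definition array_z := array_of wreath_z.

Lemma array_x2 : array_mul array_x array_x = array_one. Proof. by vm_compute. Qed.
Lemma array_y2 : array_mul array_y array_y = array_one. Proof. by vm_compute. Qed.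
Lemma array_z3 : array_mul array_z (array_mul array_z array_z) = array_one.
Proof. by vm_compute. Qed.

Lemma rep_x : represents (wreath_fun wreath_x) array_x.
Proof. exact: represents_wreath wreath_x_wf. Qed.
Lemma rep_y : represents (wreath_fun wreath_y) array_y.
Proof. exact: represents_wreath wreath_y_wf. Qed.
Lemma rep_z : represents (wreath_fun wreath_z) array_z.
Proof. exact: represents_wreath wreath_z_wf. Qed.

Lemma wreath_x_inj : injective (wreath_fun wreath_x).
Proof.
apply: (@can_inj _ _ _ (wreath_fun wreath_x)) => p.
exact: (represents_eq (represents_mul rep_x rep_x) represents_one array_x2 p).
Qed.
Lemma wreath_y_inj : injective (wreath_fun wreath_y).
Proof.
apply: (@can_inj _ _ _ (wreath_fun wreath_y)) => p.
exact: (represents_eq (represents_mul rep_y rep_y) represents_one array_y2 p).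
Qed.
Lemma wreath_z_inj : injective (wreath_fun wreath_z).
Proof.
have h := represents_mul rep_z (represents_mul rep_z rep_z).
apply: (@can_inj _ _ _ (wreath_fun wreath_z \o wreath_fun wreath_z)) => p.
exact: (represents_eq h represents_one array_z3 p).
Qed.

Definition xp : {perm block_point} := perm wreath_x_inj.
Definition yp : {perm block_point} := perm wreath_y_inj.
Definition zp : {perm block_point} := perm wreath_z_inj.

(** * The group Q inside Sym(203 * 6) x PSL(2,29), and its relators *)

Inductive letter := X | Y | Z.

Definition letter_code (c : letter) : option bool :=
  match c with X => None | Y => Some true | Z => Some false end.

Lemma letter_code_inj : injective letter_code. Proof. by do 2!case. Qed.

HB.instance Definition _ := Equality.copy letter (inj_type letter_code_inj).

Definition letter_table (c : letter) :=
  match c with X => wreath_x | Y => wreath_y | Z => wreath_z end.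
Definition letter_mx (c : letter) := match c with X => mx_x | Y => mx_y | Z => mx_z end.
Definition letter_perm (c : letter) := match c with X => xp | Y => yp | Z => zp end.

Definition word_mx (w : seq letter) : m4 := foldr (fun c => mul4 (letter_mx c)) one4 w.
Definition word_array (w : seq letter) : array :=
  foldr (fun c => array_mul (array_of (letter_table c))) array_one w.

(** With PSL(2,29) as a factor, the map from Q is a projection, and an element of its kernel is
    determined by how it permutes the points. *)
Definition wtype := ({perm block_point} * PSL2_29_carrier)%type.

Definition letter_elt (c : letter) : wtype := (letter_perm c, psl4 (letter_mx c)).
Definition word_elt (w : seq letter) : wtype := \prod_(c <- w) letter_elt c.

Definition letter_set : {set wtype} := [set letter_elt X; letter_elt Y; letter_elt Z].

Lemma letter_setP (u : wtype) : u \in letter_set <-> exists c, u = letter_elt c.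
Proof.
split=> [/setUP[/set2P[]|/set1P] ->|[c ->]]; [by exists X | by exists Y | by exists Z |].
by apply/setUP; case: c; [left; apply/set2P; left | left; apply/set2P; right | right; apply/set1P].
Qed.

Definition Q0 : {group wtype} :=
  <<letter_set>>%G.

Lemma letter_Q0 (c : letter) : letter_elt c \in Q0.
Proof. by apply: mem_gen; apply/letter_setP; exists c. Qed.

Lemma word_Q0 (w : seq letter) : word_elt w \in Q0.
Proof. by apply: group_prod => c _; apply: letter_Q0. Qed.

Lemma letter_unimod (c : letter) : unimod4 (letter_mx c).
Proof. by case: c; [apply: unimod_x | apply: unimod_y | apply: unimod_z]. Qed.

Lemma one4_unimod : unimod4 one4. Proof. by vm_compute. Qed.

Lemma word_unimod (w : seq letter) : unimod4 (word_mx w).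
Proof. by elim: w => [|c w IH]; [apply: one4_unimod | apply: unimod4M (letter_unimod c) IH]. Qed.

Lemma word_elt2 (w : seq letter) : (word_elt w).2 = psl4 (word_mx w).
Proof.
elim: w => [|c w IH]; first by rewrite /word_elt big_nil psl4_1.
rewrite /word_elt big_cons -/(word_elt w) /= IH.
exact: esym (psl4M (letter_unimod c) (word_unimod w)).
Qed.

Lemma represents_perm_mul (s t : {perm block_point}) A B :
  represents s A -> represents t B -> represents (s * t) (array_mul A B).
Proof.
move=> hs ht; have [sz h] := represents_mul hs ht; split=> // i a.
by rewrite permM; apply: h.
Qed.

Lemma represents_perm_one : represents (1 : {perm block_point}) array_one.
Proof. by have [sz h] := represents_one; split=> // i a; rewrite perm1; apply: h. Qed.

Lemma represents_letter (c : letter) : represents (letter_perm c) (array_of (letter_table c)).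
Proof.
have h f (fI : injective f) A : represents f A -> represents (perm fI) A.
  by move=> [sz hA]; split=> // i a; rewrite permE; apply: hA.
by case: c; apply: h; [apply: rep_x | apply: rep_y | apply: rep_z].
Qed.

Lemma represents_word (w : seq letter) : represents (word_elt w).1 (word_array w).
Proof.
elim: w => [|c w IH]; first by rewrite /word_elt big_nil; apply: represents_perm_one.
rewrite /word_elt big_cons -/(word_elt w).
exact: represents_perm_mul (represents_letter c) IH.
Qed.

Lemma represents_exp (s : {perm block_point}) A n :
  represents s A -> represents (s ^+ n) (array_exp A n).
Proof.
move=> h; elim: n => [|n IH]; first exact: represents_perm_one.
by rewrite expgS; apply: represents_perm_mul.
Qed.

Fixpoint exp4 (A : m4) (n : nat) : m4 := if n is m.+1 then mul4 A (exp4 A m) else one4.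

Lemma exp4_unimod (A : m4) n : unimod4 A -> unimod4 (exp4 A n).
Proof. by move=> uA; elim: n => [|n IH]; [apply: one4_unimod | apply: unimod4M]. Qed.

Lemma psl4X (A : m4) n : unimod4 A -> psl4 (exp4 A n) = psl4 A ^+ n.
Proof.
move=> uA; elim: n => [|n IH]; first exact: psl4_1.
by rewrite expgS -IH; apply: psl4M uA (exp4_unimod n uA).
Qed.

Lemma wtype_exp1 (u : wtype) n : (u ^+ n).1 = u.1 ^+ n.
Proof. by elim: n => // n IH; rewrite !expgS -IH. Qed.

Lemma wtype_exp2 (u : wtype) n : (u ^+ n).2 = u.2 ^+ n.
Proof. by elim: n => // n IH; rewrite !expgS -IH. Qed.

Lemma word_exp2 (w : seq letter) n :
  eqpm4 (exp4 (word_mx w) n) one4 -> (word_elt w ^+ n).2 = 1.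
Proof.
move=> e; rewrite wtype_exp2 word_elt2 -(psl4X n (word_unimod w)).
exact: etrans (psl4_eqpm (exp4_unimod n (word_unimod w)) e) psl4_1.
Qed.

Lemma represents_word_exp (w : seq letter) n :
  represents (word_elt w ^+ n).1 (array_exp (word_array w) n).
Proof. by rewrite wtype_exp1; apply/represents_exp/represents_word. Qed.

Lemma relatorP (w : seq letter) n :
  eqpm4 (exp4 (word_mx w) n) one4 -> array_exp (word_array w) n = array_one ->
  word_elt w ^+ n = 1.
Proof.
move=> em ea; rewrite [LHS]surjective_pairing [RHS]surjective_pairing; congr pair.
  apply/permP; exact: represents_eq (represents_word_exp w n) represents_perm_one ea.
exact: word_exp2.
Qed.

Lemma relator_x2 : word_elt [:: X] ^+ 2 = 1. Proof. by apply: relatorP; vm_compute. Qed.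
Lemma relator_y2 : word_elt [:: Y] ^+ 2 = 1. Proof. by apply: relatorP; vm_compute. Qed.
Lemma relator_z3 : word_elt [:: Z] ^+ 3 = 1. Proof. by apply: relatorP; vm_compute. Qed.
Lemma relator_yz2 : word_elt [:: Y; Z] ^+ 2 = 1. Proof. by apply: relatorP; vm_compute. Qed.
Lemma relator_zx5 : word_elt [:: Z; X] ^+ 5 = 1. Proof. by apply: relatorP; vm_compute. Qed.
Lemma relator_xy3 : word_elt [:: X; Y] ^+ 3 = 1. Proof. by apply: relatorP; vm_compute. Qed.

Lemma word_elt1 (c : letter) : word_elt [:: c] = letter_elt c.
Proof. by rewrite /word_elt big_seq1. Qed.

Lemma word_eltD (c d : letter) : word_elt [:: c; d] = letter_elt c * letter_elt d.
Proof. by rewrite /word_elt big_cons big_seq1. Qed.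

Lemma gen_set3 (gT : finGroupType) (a b c : gT) :
  <<[set a; b; c]>> = <[a]> <*> <[b]> <*> <[c]>.
Proof.
rewrite /cycle !joing_idr [<<_>> <*> [set b]]joing_idl.
by rewrite -[[set a] <*> _]/(<<_ :|: _>>) joing_idl.
Qed.

Lemma Q0_homg :
  Q0 \homg Grp (x : y : z : (x ^+ 2, y ^+ 2, z ^+ 3,
                             (y * z) ^+ 2, (z * x) ^+ 5, (x * y) ^+ 3)).
Proof.
apply/existsP; exists (letter_elt X, letter_elt Y, letter_elt Z).
have -> : Q0 :=: <[letter_elt X]> <*> <[letter_elt Y]> <*> <[letter_elt Z]>.
  exact: gen_set3.
have := relator_x2; have := relator_y2; have := relator_z3.
have := relator_yz2; have := relator_zx5; have := relator_xy3.
rewrite !word_eltD !word_elt1 => e1 e2 e3 e4 e5 e6.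
apply/eqP; congr (_, (_, (_, (_, (_, (_, _)))))).
- exact: e6.
- exact: e5.
- exact: e4.
- exact: e3.
- exact: e2.
- exact: e1.
Qed.

(** * Blocks as right cosets of A0 *)

Definition coset_rep (i : nat) : m4 := nth one4 coset_reps i.
Definition rep (i : nat) : PSL2_29_carrier := psl4 (coset_rep i).

Lemma coset_reps_unimod : all unimod4 coset_reps. Proof. by vm_compute. Qed.

Lemma coset_rep_unimod i : unimod4 (coset_rep i).
Proof.
have [li|gi] := ltnP i (size coset_reps); last by rewrite /coset_rep nth_default ?one4_unimod.
by apply: (allP coset_reps_unimod); apply: mem_nth.
Qed.

Lemma adj4_unimod (A : m4) : unimod4 A -> unimod4 (adj4 A).
Proof.
case: A => a b c d /unimod4_det uA; apply/N.eqb_spec/phi_inj => //.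
  exact/N.ltb_lt/N.mod_lt.
rewrite -det_tomx phi1 -uA /= !det_mx2 !phi_mod !phiM phi28; ring.
Qed.

Definition coset_check (c : letter) : bool :=
  all (fun i => has (eqpm4 (mul4 (mul4 (coset_rep i) (letter_mx c))
                     (adj4 (coset_rep (wreath_entry (letter_table c) i).1)))) A5_list)
      (iota 0 203).

Lemma coset_check_x : coset_check X. Proof. by vm_compute. Qed.
Lemma coset_check_y : coset_check Y. Proof. by vm_compute. Qed.
Lemma coset_check_z : coset_check Z. Proof. by vm_compute. Qed.

Lemma coset_checkP (c : letter) (i : 'I_203) :
  rep i * psl4 (letter_mx c) * (rep (wreath_entry (letter_table c) i).1)^-1 \in A0.
Proof.
have chk : coset_check c by case: c; [apply: coset_check_x | apply: coset_check_y | apply: coset_check_z].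
have li : val i \in iota 0 203 by rewrite mem_iota ltn_ord.
have /hasP[l ll e] := allP chk (val i) li.
set A := coset_rep i in e; set B := coset_rep _ in e.
have uA : unimod4 A := coset_rep_unimod _; have uB : unimod4 B := coset_rep_unimod _.
have uAc := unimod4M uA (letter_unimod c).
have e1 : psl4 (mul4 (mul4 A (letter_mx c)) (adj4 B)) = psl4 A * psl4 (letter_mx c) * (psl4 B)^-1.
  apply: etrans (psl4M uAc (adj4_unimod uB)) _.
  by rewrite (psl4M uA (letter_unimod c)) (psl4V uB).
have e2 := psl4_eqpm (unimod4M uAc (adj4_unimod uB)) e.
have -> : rep i * psl4 (letter_mx c) * (rep (wreath_entry (letter_table c) i).1)^-1 = psl4 l.
  exact (etrans (esym e1) e2).
exact: list_A0.
Qed.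

(** The last clause ties the block i to the right coset of A0 through [rep i]: the permutation part
    of w moves blocks as its PSL(2,29) part moves cosets. Such t and s compose, so their existence
    passes from the generators to all of Q. *)
Definition wreath_action (w : wtype) (t : 'I_203 -> 'I_203) (s : 'I_203 -> {perm 'I_6}) : Prop :=
  [/\ forall i, s i \in 'Alt_('I_6), forall i a, w.1 (i, a) = (t i, s i a)
    & forall i : 'I_203, rep i * w.2 * (rep (t i))^-1 \in A0].

Lemma letter_table_wf (c : letter) :
  size (letter_table c) = 203 /\ wreath_wf (letter_table c).
Proof.
by case: c; (split; first by []); [apply: wreath_x_wf | apply: wreath_y_wf | apply: wreath_z_wf].
Qed.

Lemma letter_permE (c : letter) p : letter_perm c p = wreath_fun (letter_table c) p.
Proof. by case: c; apply: permE. Qed.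

Lemma letter_action (c : letter) : exists t s, wreath_action (letter_elt c) t s.
Proof.
have [sT wf] := letter_table_wf c; have permc := letter_permE c.
set T := letter_table c in sT wf permc *.
have ent (i : 'I_203) : [&& leq (wreath_entry T i).1 202, swaps_in 5 (wreath_entry T i).2
    & ~~ odd (size (wreath_entry T i).2)].
  by move/all_nthP: wf; apply; rewrite sT.
exists (fun i => inord (wreath_entry T i).1), (fun i => swaps 5 (wreath_entry T i).2); split.
- by move=> i; have /and3P[_ ? ?] := ent i; apply: swaps_even.
- by move=> i a; apply: permc.
- move=> i; have /and3P[l1 _ _] := ent i; rewrite inordK //; exact: coset_checkP.
Qed.

Lemma Q0_action (w : wtype) : w \in Q0 -> exists t s, wreath_action w t s.
Proof.
move: w; apply: gen_ind => [|w c [t [s [sA wts rA]]] /letter_setP[d ->]].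
  exists id, (fun=> 1); split=> [i|i a|i]; rewrite ?group1 //= ?perm1 //.
  by rewrite mulg1 mulgV group1.
have [t' [s' [sA' wts' rA']]] := letter_action d.
exists (t' \o t), (fun i => s i * s' (t i)); split=> [i|i a|i].
- by rewrite groupM.
- by rewrite [(_ * _).1]/= permM wts wts' permM.
- rewrite [(_ * _).2]/=; have := groupM (rA i) (rA' (t i)).
  by rewrite !mulgA mulgKV.
Qed.

Definition blk (w : wtype) (i : 'I_203) : 'I_203 := (w.1 (i, ord0)).1.
(** Read off the permutation itself, so that the label becomes a function of w; the default 1 is
    reached only where no single permutation describes the action on the points. *)
Definition lab (w : wtype) (i : 'I_203) : {perm 'I_6} :=
  odflt 1 [pick s : {perm 'I_6} | [forall a, (w.1 (i, a)).2 == s a]].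

Lemma Q0E (w : wtype) : w \in Q0 -> wreath_action w (blk w) (lab w).
Proof.
case/Q0_action=> t [s [sA wts rA]].
have bE i : blk w i = t i by rewrite /blk wts.
have lE i : lab w i = s i.
  rewrite /lab; case: pickP => [s' /forallP h|/(_ (s i))/negP[]] /=.
    by apply/permP=> a; have /eqP <- := h a; rewrite wts.
  by apply/forallP=> a; rewrite wts.
split=> [i|i a|i]; rewrite ?bE ?lE //.
Qed.

Lemma lab_even (w : wtype) i : w \in Q0 -> lab w i \in 'Alt_('I_6).
Proof. by case/Q0E. Qed.

Lemma Q0_act (w : wtype) i a : w \in Q0 -> w.1 (i, a) = (blk w i, lab w i a).
Proof. by case/Q0E. Qed.

Lemma blkM (w w' : wtype) i : w \in Q0 -> w' \in Q0 -> blk (w * w') i = blk w' (blk w i).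
Proof. by move=> Qw Qw'; rewrite {1}/blk /= permM (Q0_act _ _ Qw) (Q0_act _ _ Qw'). Qed.

(** The cocycle rule of a wreath product: labels at i multiply only among elements that fix the
    block i. *)
Lemma labM (w w' : wtype) i :
  w \in Q0 -> w' \in Q0 -> lab (w * w') i = lab w i * lab w' (blk w i).
Proof.
move=> Qw Qw'; apply/permP=> a; have := Q0_act i a (groupM Qw Qw').
by rewrite /= !permM (Q0_act _ _ Qw) (Q0_act _ _ Qw') => -[_ ->].
Qed.

Lemma blk1 i : blk 1 i = i. Proof. by rewrite /blk perm1. Qed.

Lemma lab1 i : lab 1 i = 1.
Proof. by apply/permP=> a; have := Q0_act i a (group1 Q0); rewrite !perm1 => -[]. Qed.

Lemma blkV (w : wtype) i : w \in Q0 -> blk w^-1 (blk w i) = i.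
Proof. by move=> Qw; rewrite -blkM ?groupV // mulgV blk1. Qed.

Lemma labV (w : wtype) i : w \in Q0 -> lab w^-1 (blk w i) = (lab w i)^-1.
Proof.
by move=> Qw; apply: (mulgI (lab w i)); rewrite -labM ?groupV // !mulgV lab1.
Qed.

Lemma blk_rep (w : wtype) (i : 'I_203) : w \in Q0 -> rep i * w.2 * (rep (blk w i))^-1 \in A0.
Proof. by case/Q0E. Qed.

Lemma Q0_PSL (w : wtype) : w \in Q0 -> w.2 \in PSL2_29.
Proof.
move: w; apply: gen_ind => [|w c Pw /letter_setP[d ->]]; first exact: group1.
apply: groupM Pw _.
by case: d; [apply: xb_in | apply: yb_in | apply: zb_in].
Qed.

(** * Surjectivity onto PSL(2,29) *)

Section Elementary.
Local Open Scope ring_scope.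

Lemma mx2_elementary (R : fieldType) (a b c d : R) : c != 0 -> a * d - b * c = 1 ->
  mx2 a b c d = mx2 1 ((a - 1) / c) 0 1 *m mx2 1 0 c 1 *m mx2 1 ((d - 1) / c) 0 1.
Proof.
move=> c0 det1; have eb : b = (a * d - 1) / c.
  by rewrite -det1 opprB addrC subrK mulfK.
by rewrite !mx2M; congr mx2; rewrite ?eb; field.
Qed.

Lemma elementary_ind (R : fieldType) (P : 'M[R]_2 -> Prop) :
  (forall A B, P A -> P B -> P (A *m B)) -> (forall s, P (mx2 1 s 0 1)) ->
  (forall s, P (mx2 1 0 s 1)) -> forall A, \det A = 1 -> P A.
Proof.
move=> PM Pup Plo A; rewrite [A]mx2_eta det_mx2.
move: (A 0 0) (A 0 1) (A 1 0) (A 1 1) => a b c d {A} dA.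
have nz x y z t : z != 0 -> x * t - y * z = 1 -> P (mx2 x y z t).
  by move=> z0 e; rewrite (mx2_elementary z0 e); do 2!apply: (PM) => //.
have [c0|c0] := eqVneq c 0; last exact: nz.
have d0 : d != 0 by apply/eqP=> d0; move/eqP: dA; rewrite c0 d0 !mulr0 subr0 eq_sym oner_eq0.
(* For c = 0 a lower elementary factor moves d, which is nonzero, into the lower left corner. *)
have -> : mx2 a b c d = mx2 (a + b) b d d *m mx2 1 0 (- 1) 1.
  by rewrite mx2M c0; congr mx2; ring.
by apply: PM => //; apply: nz => //; rewrite -dA c0; ring.
Qed.

End Elementary.

(** Words giving, up to sign, one upper and one lower elementary matrix. Their powers give all
    elementary matrices, the field being of prime order, and these generate SL(2,29). *)
Definition word_e := [:: X; Z; Z; X; Z; X; Y; Z; X; Z; X; Y; Z; X; Z; Y; X; Z].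
Definition word_f := [:: Y; X; Z; Z; X; Z; Y; X; Z; X; Z; Z; X; Z; Y; X; Z].

Lemma word_e_mx : eqpm4 (word_mx word_e) (M4 1 1 0 1). Proof. by vm_compute. Qed.
Lemma word_f_mx : eqpm4 (word_mx word_f) (M4 1 0 1 1). Proof. by vm_compute. Qed.

Definition lifts (A : 'M[F]_2) : Prop :=
  (\det A = 1)%R /\ exists2 w : wtype, w \in Q0 & w.2 = psl29 A.

Lemma lifts_mul (A B : 'M[F]_2) : lifts A -> lifts B -> lifts (A *m B)%R.
Proof.
move=> [dA [u Qu eu]] [dB [v Qv ev]]; have [e d] := psl29SM dA dB.
split; first exact: d.
by exists (u * v); [apply: groupM | rewrite e -eu -ev].
Qed.

Lemma lifts_word (w : seq letter) (A : m4) : eqpm4 (word_mx w) A -> unimod4 A -> lifts (tomx A).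
Proof.
move=> e uA; split; first exact: unimod4_det.
exists (word_elt w); first exact: word_Q0.
rewrite word_elt2; exact: psl4_eqpm (word_unimod w) e.
Qed.

Lemma lifts_power (A : F -> 'M[F]_2) :
  A 0%R = 1%:M%R -> (forall s t, A (s + t)%R = A s *m A t)%R -> lifts (A 1%R) -> forall s, lifts (A s).
Proof.
move=> A0 AD A1 s; rewrite -[s]natr_Zp; elim: (nat_of_ord s) => [|n IH].
  rewrite A0; split; first exact: det1.
  by exists 1; [apply: group1 | apply: esym psl29_1].
by rewrite mulrSr AD; apply: lifts_mul.
Qed.

Lemma lifts_upper s : lifts (mx2 1 s 0 1)%R.
Proof.
apply: (@lifts_power (fun s => mx2 1 s 0 1)%R) => [|a b|]; first exact: esym (mx2_1 _).
  by rewrite mx2M; congr mx2; ring.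
have -> : (mx2 1 1 0 1 = tomx (M4 1 1 0 1))%R by rewrite /= phi0 phi1.
apply: lifts_word word_e_mx _; vm_compute; reflexivity.
Qed.

Lemma lifts_lower s : lifts (mx2 1 0 s 1)%R.
Proof.
apply: (@lifts_power (fun s => mx2 1 0 s 1)%R) => [|a b|]; first exact: esym (mx2_1 _).
  by rewrite mx2M; congr mx2; ring.
have -> : (mx2 1 0 1 1 = tomx (M4 1 0 1 1))%R by rewrite /= phi0 phi1.
apply: lifts_word word_f_mx _; vm_compute; reflexivity.
Qed.

Lemma lifts_all (A : 'M[F]_2) : (\det A = 1)%R -> lifts A.
Proof. exact: (elementary_ind lifts_mul lifts_upper lifts_lower). Qed.

Lemma Q0_surj (u : PSL2_29_carrier) : u \in PSL2_29 -> exists2 w, w \in Q0 & w.2 = u.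
Proof. by case/psl29_surj=> A /lifts_all[_ [w Qw ew]] ->; exists w. Qed.

(** * Block stabilisers and transitivity *)

Definition distinct_check : bool :=
  all (fun r => ~~ has (eqpm4 r) A5_list) (behead coset_reps).

Lemma distinct_checkT : distinct_check. Proof. by vm_compute. Qed.
Lemma coset_reps_reduced : all reduced4 coset_reps. Proof. by vm_compute. Qed.
Lemma A5_list_reduced : all reduced4 A5_list. Proof. by vm_compute. Qed.

Lemma rep0 : rep 0 = 1. Proof. exact: psl4_1. Qed.

Lemma rep_A0 (j : 'I_203) : rep j \in A0 -> j = ord0.
Proof.
case/A0_list=> l ll e; apply/val_inj/eqP; rewrite /= -leqn0 leqNgt; apply/negP=> j0.
have sz : size coset_reps = 203 by vm_compute.
have jin : coset_rep j \in coset_reps by apply: mem_nth; rewrite sz.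
have ep : eqpm4 (coset_rep j) l.
  apply: psl4_inj e; [exact: coset_rep_unimod | exact: (allP A5_list_unimod) | |].
    exact: (allP coset_reps_reduced).
  exact: (allP A5_list_reduced).
have jin' : coset_rep j \in behead coset_reps.
  have -> : coset_rep j = nth one4 (behead coset_reps) j.-1 by rewrite nth_behead prednK.
  by apply: mem_nth; rewrite size_behead sz prednK // -ltnS ltn_ord.
by have /hasP[] := allP distinct_checkT _ jin'; exists l.
Qed.

(** The comparison of the representatives with A0 settles the block 0; transitivity transports the
    result to the other blocks. *)
Lemma blk0_A0 (w : wtype) : w \in Q0 -> (blk w ord0 == ord0) = (w.2 \in A0).
Proof.
move=> Qw; have := blk_rep ord0 Qw; rewrite rep0 mul1g => h.
apply/eqP/idP => [e|wA]; first by move: h; rewrite e rep0 invg1 mulg1.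
by apply: rep_A0; rewrite -groupV -(groupMl _ wA).
Qed.

(* One of x, y, z, z ^ 2 moves each nonzero block to one of smaller index. *)
Definition descent_check : bool :=
  all (fun i => let z := (wreath_entry wreath_z i).1 in
    [|| ltn (wreath_entry wreath_x i).1 i, ltn (wreath_entry wreath_y i).1 i,
        ltn z i | ltn (wreath_entry wreath_z z).1 i]) (iota 1 202).

Lemma descent_checkT : descent_check. Proof. by vm_compute. Qed.

Lemma blk_letter (c : letter) (i : 'I_203) :
  blk (letter_elt c) i = (wreath_entry (letter_table c) i).1 :> nat.
Proof.
have [sT /all_nthP wf] := letter_table_wf c.
have /and3P[l1 _ _] : [&& leq (wreath_entry (letter_table c) i).1 202,
  swaps_in 5 (wreath_entry (letter_table c) i).2
  & ~~ odd (size (wreath_entry (letter_table c) i).2)] by apply: wf; rewrite sT.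
by rewrite /blk [(letter_elt c).1]/= letter_permE /= inordK.
Qed.

Lemma blk_trans (i : 'I_203) : exists2 w, w \in Q0 & blk w i = ord0.
Proof.
have [n] := ubnP (nat_of_ord i); elim: n i => // n IH i lin.
have [i0|i0] := posnP i.
  by exists 1; [apply: group1 | rewrite blk1; apply/val_inj].
have step w : w \in Q0 -> blk w i < i -> exists2 w, w \in Q0 & blk w i = ord0.
  move=> Qw lt; have [w' Qw' e] := IH (blk w i) (leq_trans lt lin).
  by exists (w * w'); [apply: groupM | rewrite blkM].
have ii : val i \in iota 1 202 by rewrite mem_iota i0 /= ltn_ord.
have Qzz := groupM (letter_Q0 Z) (letter_Q0 Z).
have ex : blk (letter_elt X) i = (wreath_entry wreath_x i).1 :> nat := blk_letter X i.
have ey : blk (letter_elt Y) i = (wreath_entry wreath_y i).1 :> nat := blk_letter Y i.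
have ez : blk (letter_elt Z) i = (wreath_entry wreath_z i).1 :> nat := blk_letter Z i.
have ezz : blk (letter_elt Z * letter_elt Z) i =
    (wreath_entry wreath_z (wreath_entry wreath_z i).1).1 :> nat.
  by rewrite blkM ?letter_Q0 // -ez; apply: (blk_letter Z).
have /or4P[] : [|| (wreath_entry wreath_x i).1 < i, (wreath_entry wreath_y i).1 < i,
    (wreath_entry wreath_z i).1 < i | (wreath_entry wreath_z (wreath_entry wreath_z i).1).1 < i].
- exact: allP descent_checkT _ ii.
- by rewrite -ex; apply: step; apply: letter_Q0.
- by rewrite -ey; apply: step; apply: letter_Q0.
- by rewrite -ez; apply: step; apply: letter_Q0.
- by rewrite -ezz; apply: step.
Qed.

(** Conjugating by an element that carries i to the block 0 gives an element over 1, which lies in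
    A0 and so fixes the block 0. *)
Lemma blk_ker (w : wtype) i : w \in Q0 -> w.2 = 1 -> blk w i = i.
Proof.
move=> Qw w2; have [v Qv vi] := blk_trans i.
have Qvw : v^-1 * w * v \in Q0 by rewrite !groupM ?groupV.
have : blk (v^-1 * w * v) ord0 == ord0.
  by rewrite blk0_A0 //= w2 mulg1 mulVg group1.
rewrite !blkM ?groupM ?groupV // -{1}vi blkV // => /eqP e.
by rewrite -(blkV (blk w i) Qv) e -vi blkV.
Qed.

(** * The kernels of the actions on the blocks *)

Definition R0_set : {set wtype} := [set w in Q0 | w.2 == 1].

Lemma R0P (w : wtype) : reflect (w \in Q0 /\ w.2 = 1) (w \in R0_set).
Proof. by rewrite inE; apply: (iffP andP) => -[Qw /eqP]. Qed.

Lemma R0_group_set : group_set R0_set.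
Proof.
apply/group_setP; split=> [|u v /R0P[Qu u2] /R0P[Qv v2]]; apply/R0P.
  by split; first exact: group1.
by split; [apply: groupM | rewrite /= u2 v2 mulg1].
Qed.

Canonical R0 : {group wtype} := Group R0_group_set.

Definition S0_set : {set wtype} := [set w in Q0 | w.2 \in A0].

Lemma S0P (w : wtype) : reflect (w \in Q0 /\ w.2 \in A0) (w \in S0_set).
Proof. by rewrite inE; apply: andP. Qed.

Lemma S0_group_set : group_set S0_set.
Proof.
apply/group_setP; split=> [|u v /S0P[Qu u2] /S0P[Qv v2]]; apply/S0P.
  by split; apply: group1.
by split; apply: groupM.
Qed.

Canonical S0 : {group wtype} := Group S0_group_set.

Definition K_set (i : 'I_203) : {set wtype} := [set w in R0 | lab w i == 1].

Lemma KP (i : 'I_203) (w : wtype) :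
  reflect [/\ w \in Q0, w.2 = 1 & lab w i = 1] (w \in K_set i).
Proof.
rewrite inE; apply: (iffP andP) => [[/R0P[Qw w2] /eqP]|[Qw w2 ->]] //.
by split=> //; apply/R0P.
Qed.

Lemma K_group_set i : group_set (K_set i).
Proof.
apply/group_setP; split=> [|u v /KP[Qu u2 lu] /KP[Qv v2 lv]]; apply/KP.
  by split; rewrite ?group1 ?lab1.
by split; rewrite ?groupM //= ?u2 ?v2 ?mulg1 // labM // blk_ker // lu lv mulg1.
Qed.

Canonical K i : {group wtype} := Group (K_group_set i).

Lemma R0_sub_Q0 : R0 \subset Q0. Proof. by apply/subsetP=> w /R0P[]. Qed.
Lemma R0_sub_S0 : R0 \subset S0.
Proof. by apply/subsetP=> w /R0P[Qw w2]; apply/S0P; rewrite w2 group1. Qed.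
Lemma S0_sub_Q0 : S0 \subset Q0. Proof. by apply/subsetP=> w /S0P[]. Qed.
Lemma K_sub_R0 i : K i \subset R0.
Proof. by apply/subsetP=> w /KP[Qw w2 _]; apply/R0P. Qed.

Lemma R0_normal : R0 <| Q0.
Proof.
rewrite /normal R0_sub_Q0; apply/subsetP=> v Qv; rewrite inE.
apply/subsetP=> _ /imsetP[w /R0P[Qw w2] ->]; apply/R0P; split; first exact: groupJ.
by rewrite /= w2 mul1g mulVg.
Qed.

Lemma labJ (w v : wtype) i : w \in R0 -> v \in Q0 ->
  lab (w ^ v) (blk v i) = lab w i ^ lab v i.
Proof.
move=> /R0P[Qw w2] Qv; rewrite /conjg labM ?groupM ?groupV // labV // blkV //.
by rewrite labM // blk_ker.
Qed.

(** Source of three facts: the [K i] have equal orders, they are normal in R0 and, once known to be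
    distinct, an element of Q normalising [K i] fixes the block i. *)
Lemma KJ (v : wtype) i : v \in Q0 -> K i :^ v = K (blk v i).
Proof.
move=> Qv; have sub u j : u \in Q0 -> K j :^ u \subset K (blk u j).
  move=> Qu; apply/subsetP=> _ /imsetP[w Kw ->].
  have Rw := subsetP (K_sub_R0 j) w Kw; have /KP[Qw w2 lw] := Kw.
  have /R0P[QJ J2] : w ^ u \in R0 by rewrite memJ_norm // (subsetP (normal_norm R0_normal)).
  by apply/KP; split=> //; rewrite labJ // lw conj1g.
apply/eqP; rewrite eqEsubset sub //= -(conjsgKV v (K (blk v i))) conjSg.
by rewrite -{2}(blkV i Qv) sub ?groupV.
Qed.

Lemma card_K i : #|K i| = #|K ord0|.
Proof. by have [v Qv <-] := blk_trans i; rewrite -KJ // cardJg. Qed.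

Lemma K_normal i : K i <| R0.
Proof.
rewrite /normal K_sub_R0; apply/subsetP=> v /R0P[Qv v2]; apply/normP.
by rewrite KJ // blk_ker.
Qed.

Lemma bigcap_K : \bigcap_i K i \subset [1 wtype].
Proof.
apply/subsetP=> w /bigcapP h; have /KP[Qw w2 _] := h ord0 isT.
rewrite inE; apply/eqP; rewrite [w]surjective_pairing [RHS]surjective_pairing w2.
congr pair; apply/permP=> -[i a]; have /KP[_ _ li] := h i isT.
by rewrite (Q0_act i a Qw) li blk_ker // !perm1.
Qed.

Lemma sigma_morph : {in S0 &, {morph (fun w => lab w ord0) : u v / u * v}}.
Proof.
move=> u v /S0P[Qu uA] /S0P[Qv vA]; rewrite labM //.
by have := blk0_A0 Qu; rewrite uA => /eqP->.
Qed.

(** The quotient A6 of the preimage of A0: on S0, which fixes the block 0, the labels there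
    multiply. *)
Definition sigma : {morphism S0 >-> {perm 'I_6}} := Morphism sigma_morph.

Definition label_check (w : seq letter) (n : nat) (l : seq (nat * nat)) : bool :=
  let e := entry (array_exp (word_array w) n) 0 in
  [&& eqn e.1 0, swaps_in 5 l & all (fun a => eqn (nth 0 e.2 a) (foldl swapn a l)) (iota 0 6)].

Lemma label_checkP (w : seq letter) n l : label_check w n l ->
  word_elt w ^+ n \in S0 /\ lab (word_elt w ^+ n) ord0 = swaps 5 l.
Proof.
case/and3P=> /eqP e1 il /allP chk; have Qw := groupX n (word_Q0 w).
have [_ h] := represents_word_exp w n.
split.
  apply/S0P; split=> //; rewrite -blk0_A0 //; apply/eqP/val_inj.
  by have [+ _ _] := h ord0 ord0; rewrite (Q0_act _ _ Qw) /= => ->.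
apply/permP=> a; apply/val_inj; rewrite /= swaps_val //.
have [_ + _] := h ord0 a; rewrite (Q0_act _ _ Qw) => /= ->.
by apply/eqP; rewrite -eqnE; apply: chk; rewrite mem_iota /= ltn_ord.
Qed.

(** [word5] and [word3a] involve x and z only and so lie over A0. The images of [word4] and [word3b]
    in PSL(2,29) have orders dividing 7 and 14, so the 7th and the 14th powers lie over 1. *)
Definition word4 := [:: X; Y; Z; X; Z; X; Z; Z].
Definition word5 := [:: X; Z].
Definition word3a := [:: Z; X; Z; X; Z; Z].
Definition word3b := [:: Y; X; Z; X; Z; Y; X].

Definition cycles4 : seq (nat * nat) := [:: (0, 4); (1, 3); (1, 2); (1, 5)]%N.
Definition cycle5 : seq (nat * nat) := [:: (1, 5); (1, 3); (1, 4); (1, 2)]%N.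
Definition cycle3a : seq (nat * nat) := [:: (2, 4); (2, 3)]%N.
Definition cycle3b : seq (nat * nat) := [:: (0, 5); (0, 1)]%N.

Lemma label_check4 : label_check word4 7 cycles4. Proof. by vm_compute. Qed.
Lemma label_check5 : label_check word5 1 cycle5. Proof. by vm_compute. Qed.
Lemma label_check3a : label_check word3a 1 cycle3a. Proof. by vm_compute. Qed.
Lemma label_check3b : label_check word3b 14 cycle3b. Proof. by vm_compute. Qed.

Lemma card_Alt6 : #|'Alt_('I_6)| = 360.
Proof. by apply: double_inj; rewrite -mul2n card_Alt card_ord. Qed.

Lemma simple_Alt6 : simple 'Alt_('I_6).
Proof. by apply: simple_Alt5; rewrite card_ord. Qed.

Lemma nonabelian_Alt6 : ~~ abelian 'Alt_('I_6).
Proof.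
apply/negP=> /abelian_sol solA.
by have := simple_sol_prime solA simple_Alt6; rewrite card_Alt6.
Qed.

(** Elements of orders 4 and 5 and two disjoint 3-cycles make 180 divide the order of the image,
    which is then all of the simple group A6. *)
Lemma sigma_im : sigma @* S0 = 'Alt_('I_6).
Proof.
pose H := (sigma @* S0)%G.
have inH w n l : label_check w n l -> swaps 5 l \in H.
  by move=> /label_checkP[Sw <-]; rewrite (mem_morphim sigma).
have H4 := inH _ _ _ label_check4; have H5 := inH _ _ _ label_check5.
have H3a := inH _ _ _ label_check3a; have H3b := inH _ _ _ label_check3b.
have sHA : H \subset 'Alt_('I_6).
  by apply/subsetP=> _ /morphimP[w _ /S0P[Qw _] ->]; apply: lab_even.
apply: (@simple_large_subgroup _ [group of 'Alt_('I_6)] H 180) => //.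
- exact: simple_Alt6.
- exact: card_Alt6.
have o5 : 5 %| #|H|.
  have := order_dvdG H5; rewrite (@order_prime_perm _ 5) //.
    by rewrite !expgS expg0 mulg1 -!swaps_cat; apply: swaps_eq1; vm_compute.
  by apply: swaps_neq1; vm_compute.
have o4 : 4 %| #|H|.
  apply: dvdn_trans (order_dvdG H4).
  have e4 : swaps 5 cycles4 ^+ 4 = 1.
    by rewrite !expgS expg0 mulg1 -!swaps_cat; apply: swaps_eq1; vm_compute.
  have n2 : swaps 5 cycles4 ^+ 2 <> 1.
    by rewrite !expgS expg0 mulg1 -!swaps_cat; apply: swaps_neq1; vm_compute.
  have : #[swaps 5 cycles4] %| 4 by rewrite order_dvdn e4.
  have : ~~ (#[swaps 5 cycles4] %| 2) by rewrite order_dvdn; apply/eqP.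
  by move=> d2; rewrite dvdn_divisors // !inE => /or3P[]/eqP e; rewrite e in d2 *.
have o9 : 9 %| #|H|.
  set a := swaps 5 cycle3a in H3a; set b := swaps 5 cycle3b in H3b.
  have oa : #[a] = 3.
    apply: order_prime_perm => //; last by apply: swaps_neq1; vm_compute.
    by rewrite !expgS expg0 mulg1 -!swaps_cat; apply: swaps_eq1; vm_compute.
  have ob : #[b] = 3.
    apply: order_prime_perm => //; last by apply: swaps_neq1; vm_compute.
    by rewrite !expgS expg0 mulg1 -!swaps_cat; apply: swaps_eq1; vm_compute.
  have cab : <[a]> \subset 'C(<[b]>).
    rewrite cents_cycle //; apply/permP=> i; apply/val_inj.
    rewrite /= /commute -!swaps_cat !swaps_val //.
    by case: i => [[|[|[|[|[|[|]]]]]]].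
  have ti : <[a]> :&: <[b]> = 1.
    apply: prime_TIg; first by rewrite -orderE oa.
    rewrite cycle_subG; apply/negP=> /cycleP[k eab].
    (* The point 2 is fixed by all powers of b but moved by a. *)
    have fb : b (inord 2) = inord 2.
      by apply/val_inj; rewrite /= swaps_val // inordK.
    have := permX_fix k fb; rewrite -eab => /(congr1 (@nat_of_ord _)).
    by rewrite swaps_val // !inordK.
  have c9 : #|<[a]> <*> <[b]>| = 9.
    by rewrite cent_joinEl // TI_cardMg // -!orderE oa ob.
  have sub : <[a]> <*> <[b]> \subset H by rewrite join_subG !cycle_subG H3a.
  by have := cardSg sub; rewrite c9.
by rewrite (@Gauss_dvd 36 5) // o5 andbT (@Gauss_dvd 4 9) // o4.
Qed.

(* The 14th powers of these words lie in the kernel R0, and have order 3 on the block 0 but,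
   for each other block, at least one of them does not have order dividing 3 there. *)
Definition separating_words :=
  [:: [:: X; Y; X; Z; X; Y; Z]; [:: X; Y; X; Z; X; Z; Y];
      [:: Y; X; Z; X; Y; Z; X]; [:: Y; X; Z; X; Z; Y; X]].

Definition fixes_block (A : array) (i : nat) : bool := all2 eqn (entry A i).2 (iota 0 6).

Definition separating_arrays :=
  [seq array_exp (array_exp (word_array w) 14) 3 | w <- separating_words].

Definition separation_check0 : bool := all (fun A => fixes_block A 0) separating_arrays.

Definition separation_check : bool :=
  let L := separating_arrays in
  all (fun j => has (fun A => ~~ fixes_block A j) L) (iota 1 202).

Lemma separation_check0T : separation_check0. Proof. by vm_compute. Qed.
Lemma separation_checkT : separation_check. Proof. by vm_compute. Qed.

Lemma separating_words_ker :
  all (fun w => eqpm4 (exp4 (word_mx w) 14) one4) separating_words.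
Proof. by vm_compute. Qed.

Lemma fixes_blockP (w : wtype) A (i : 'I_203) :
  w \in Q0 -> represents w.1 A -> fixes_block A i = (lab w i == 1).
Proof.
move=> Qw [_ h]; have [_ _ sz] := h i ord0.
have eqn_nth s t : all2 eqn s t = (s == t :> seq nat).
  by elim: s t => [|x s IH] [|y t] //=; rewrite IH.
rewrite /fixes_block eqn_nth; apply/eqP/eqP => [e|e1].
  apply/permP=> a; apply/val_inj; have [_ + _] := h i a.
  by rewrite (Q0_act _ _ Qw) /= => ->; rewrite e nth_iota ?ltn_ord // perm1.
apply: (@eq_from_nth _ 0%N) => [|a]; rewrite sz ?size_iota // => la.
have e : nth 0%N (entry A i).2 a = a.
  by have [_ + _] := h i (Ordinal la); rewrite (Q0_act _ _ Qw) e1 /= perm1 /= => <-.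
by rewrite e nth_iota.
Qed.

Lemma separating_word_R0 w : w \in separating_words -> word_elt w ^+ 14 \in R0.
Proof.
move=> ws; apply/R0P; split; first exact: groupX (word_Q0 w).
exact: word_exp2 (allP separating_words_ker w ws).
Qed.

Lemma represents_separating w : represents (word_elt w ^+ 14 ^+ 3).1
  (array_exp (array_exp (word_array w) 14) 3).
Proof. by rewrite wtype_exp1; apply/represents_exp/represents_word_exp. Qed.

Lemma K_ord0_inj (j : 'I_203) : K j = K ord0 -> j = ord0.
Proof.
move=> eK; apply/eqP/negPn/negP => j0.
have jj : val j \in iota 1 202.
  rewrite mem_iota ltn_ord andbT lt0n; apply: contra j0 => /eqP e.
  exact/eqP/val_inj.
have /hasP[A Aw nfix] : has (fun A => ~~ fixes_block A j) separating_arrays.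
  exact: (allP separation_checkT _ jj).
have f0 : fixes_block A 0 := allP separation_check0T A Aw.
case/mapP: Aw => w ws eA; rewrite {}eA in nfix f0.
have := represents_separating w; have := groupX 3 (separating_word_R0 ws).
move: (word_elt w ^+ 14 ^+ 3) (array_exp _ 3) nfix f0 => r B nfix f0 /R0P[Qr r2] rB.
have kr : r \in K ord0.
  by apply/KP; split=> //; apply/eqP; rewrite -(fixes_blockP ord0 Qr rB).
have kj : r \in K j by rewrite eK.
by case/KP: kj => _ _ lj; case/negP: nfix; rewrite (fixes_blockP j Qr rB) lj.
Qed.

(** Transitivity moves one of the two blocks to 0, the only case examined by computation. *)
Lemma K_inj : injective K.
Proof.
move=> i j eK; have [v Qv vi] := blk_trans i.
have e : K (blk v j) = K (blk v i).
  apply: group_inj; apply: etrans (esym (KJ j Qv)) (etrans _ (KJ i Qv)).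
  by rewrite eK.
rewrite vi in e; have ej := K_ord0_inj e.
by rewrite -(blkV i Qv) -(blkV j Qv) vi ej.
Qed.

Definition word_r := [:: X; Y; X; Z; X; Y; Z].

Lemma word_r_moves : ~~ fixes_block (array_exp (word_array word_r) 14) 0.
Proof. by vm_compute. Qed.

(** R0 is normal in S0, so its image is normal in A6, and one nontrivial label makes it
    everything. *)
Lemma sigma_R0 : sigma @* R0 = 'Alt_('I_6).
Proof.
have nR : sigma @* R0 <| 'Alt_('I_6).
  rewrite -sigma_im; apply: morphim_normal.
  exact: normalS R0_sub_S0 S0_sub_Q0 R0_normal.
have [_ simA] := simpleP _ simple_Alt6.
have [R1|//] := simA (sigma @* R0)%G nR.
have Rw : word_elt word_r ^+ 14 \in R0 by apply: separating_word_R0.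
have /R0P[Qw _] := Rw.
case/negP: word_r_moves.
rewrite (fixes_blockP ord0 Qw (represents_word_exp _ _)); apply/eqP/set1gP.
have <- : sigma @* R0 = 1 := R1.
exact: (mem_morphim sigma (subsetP R0_sub_S0 _ Rw) Rw).
Qed.

Lemma index_K i : #|R0 : K i| = 360.
Proof.
have cK : #|R0 : K ord0| = 360.
  have -> : K ord0 :=: R0 :&: 'ker sigma.
    apply/setP=> w; apply/KP/setIP => [[Qw w2 l1]|[/R0P[Qw w2] /morphpreP[_ /set1P l1]]] //.
    have Rw : w \in R0 by apply/R0P.
    by split=> //; apply/morphpreP; split; [apply: (subsetP R0_sub_S0) | apply/set1P].
  rewrite indexgI -card_Alt6 -sigma_R0 card_morphim.
  by rewrite (setIidPr R0_sub_S0).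
apply/eqP; rewrite -cK -(eqn_pmul2l (cardG_gt0 (K i))) Lagrange ?K_sub_R0 //.
by rewrite card_K Lagrange ?K_sub_R0.
Qed.

(** * The preimages of the two classes *)

Section Twist.
Variable h : PSL2_29_carrier.

Lemma twist_morph : {in Q0 &, {morph (fun w : wtype => w.2 ^ h) : u v / u * v}}.
Proof. by move=> u v _ _; rewrite /= conjMg. Qed.

(** The conjugation by h is the automorphism that replaces A0 by [G1]: with it the preimage of [G1]
    = A0 :^ h is S0, whatever the class of [G1]. *)
Definition twist : {morphism Q0 >-> PSL2_29_carrier} := Morphism twist_morph.

Lemma ker_twist : 'ker twist = R0.
Proof.
apply/setP=> w; apply/idP/R0P => [/morphpreP[Qw /set1P /eqP]|[Qw w2]].
  by rewrite conjg_eq1 => /eqP.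
by apply/morphpreP; split; rewrite // inE /= w2 conj1g.
Qed.

Lemma twist_im : h \in 'N(PSL2_29) -> twist @* Q0 = PSL2_29.
Proof.
move=> hN; apply/setP=> u; apply/morphimP/idP => [[w _ Qw ->]|uP].
  by rewrite memJ_norm //; apply: Q0_PSL.
have [|w Qw w2] := @Q0_surj (u ^ h^-1); first by rewrite memJ_norm ?groupV.
by exists w; rewrite //= w2 conjgKV.
Qed.

Lemma twist_pre_A0 : twist @*^-1 (A0 :^ h) = S0.
Proof.
apply/setP=> w; apply/morphpreP/S0P => [[Qw]|[Qw wA]]; last by rewrite memJ_conjg.
by rewrite /= memJ_conjg.
Qed.

End Twist.

Lemma pull_simple_quotient (gT rT : finGroupType) (P S : {group gT}) (A : {group rT})
    (s : {morphism S >-> rT}) :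
  P \isog S -> s @* S = A -> exists2 N : {group gT}, N <| P & P / N \isog A.
Proof.
case/isogP=> g injg img ims.
have mor : {in P &, {morph s \o g : u v / u * v}}.
  by move=> u v Pu Pv; rewrite /= morphM // morphM // -img mem_morphim.
exists ('ker (Morphism mor))%G; first exact: ker_normal.
suff <- : Morphism mor @* P = A by apply: first_isog.
rewrite -ims; apply/setP=> u; apply/morphimP/morphimP => [[w _ Pw ->]|[v _ Sv ->]].
  have Sw : g w \in S by rewrite -img mem_morphim.
  by exists (g w).
have : v \in g @* P by rewrite img.
by case/morphimP=> w _ Pw ->; exists w.
Qed.

Lemma conj_rearrange (gT : finGroupType) (r u h : gT) :
  u = ((r * u ^ h^-1 * r^-1) ^ h) ^ (r ^ h).
Proof.
have -> : (r * u ^ h^-1 * r^-1) ^ h = r ^ h * u * (r ^ h)^-1.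
  by rewrite conjMg conjMg conjVg conjgKV.
by move: (r ^ h) => t; rewrite conjgE mulgKV mulKg.
Qed.

Lemma preimages_not_isog (h : PSL2_29_carrier) (G2 : {group PSL2_29_carrier}) :
  h \in 'N(PSL2_29) -> G2 \subset PSL2_29 -> #|G2| = 60 -> #|A0| = 60 ->
  (forall g : PSL2_29_carrier, g \in PSL2_29 -> G2 :<>: (A0 :^ h) :^ g) ->
  ~~ (twist h @*^-1 (A0 :^ h) \isog twist h @*^-1 G2).
Proof.
move=> hN sG2 cG2 cA0 nconj; rewrite twist_pre_A0; apply/negP=> iso.
pose P2 := (twist h @*^-1 G2)%G.
have sP2 : P2 \subset Q0 by apply: subsetIl.
have [N nN isoN] : exists2 N : {group wtype}, N <| P2 & P2 / N \isog 'Alt_('I_6).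
  have iso' : P2 \isog S0 by rewrite isog_sym.
  exact: (@pull_simple_quotient _ _ P2 S0 'Alt_('I_6)%G sigma iso' sigma_im).
have sR : R0 \subset P2.
  by apply/subsetP=> w /R0P[Qw w2]; apply/morphpreP; split; rewrite //= w2 conj1g.
have cP2 : #|P2| = (#|R0| * 60)%N.
  by rewrite card_morphpre ?twist_im // ker_twist cG2.
have iR : #|P2 : R0| = 60 by rewrite -divgS // cP2 mulKn.
have cN : #|P2 : N| = 360.
  by rewrite -card_quotient ?normal_norm // (card_isog isoN) card_Alt6.
have [||||||||i fixK] := @subdirect_simple_quotient _ P2 R0 N _ K.
- exact: normalS sR sP2 R0_normal.
- exact: nN.
- by rewrite (isog_simple isoN) simple_Alt6.
- by rewrite (isog_abelian isoN) nonabelian_Alt6.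
- by rewrite cN iR.
- exact: K_normal.
- by move=> i; rewrite cN index_K.
- exact: bigcap_K.
(* Conjugation by w sends [K i] to [K (blk w i)], but P2 normalises [K i], and distinct blocks have
   distinct kernels. *)
have fix_i w : w \in P2 -> blk w i = i.
  move=> Pw; apply: K_inj; apply: group_inj.
  apply: etrans (esym (KJ i (subsetP sP2 w Pw))) _.
  exact: (normP (subsetP fixK w Pw)).
(* The stabiliser of the block i lies over A0 conjugated by [rep i]; twisting by h turns this into
   A0 :^ h conjugated by [k]. *)
pose k := rep i ^ h.
have ri : rep i \in PSL2_29 := psl29_in (unimod4_det (coset_rep_unimod i)).
have kP : k \in PSL2_29 by rewrite memJ_norm.
case: (nconj k kP); apply/eqP; rewrite eqEcard !cardJg cA0 cG2 leqnn andbT.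
apply/subsetP=> u uG2; have uP := subsetP sG2 u uG2.
have [|w Qw w2] := @Q0_surj (u ^ h^-1); first by rewrite memJ_norm ?groupV.
have Pw : w \in P2 by apply/morphpreP; split; rewrite //= w2 conjgKV.
have aA := blk_rep i Qw; rewrite fix_i // w2 in aA.
by rewrite (conj_rearrange (rep i) u h) !memJ_conjg.
Qed.

Theorem theorem1p7 (G1 G2 : {group PSL2_29_carrier}) :
  G1 \subset PSL2_29 -> G2 \subset PSL2_29 ->
  G1 \isog 'Alt_('I_5) -> G2 \isog 'Alt_('I_5) ->
  (G2 : {set PSL2_29_carrier}) \notin (G1 :^: PSL2_29) ->
  exists (qT : finGroupType) (Q : {group qT}),
    (Q \homg Grp (x : y : z : (x ^+ 2, y ^+ 2, z ^+ 3,
                               (y * z) ^+ 2, (z * x) ^+ 5, (x * y) ^+ 3))) /\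
    exists f : {morphism Q >-> PSL2_29_carrier},
      f @* Q = PSL2_29 /\ ~~ (f @*^-1 G1 \isog f @*^-1 G2).
Proof.
move=> sG1 sG2 iso1 iso2 nconj.
have [h hN eG1] := A5_conj sG1 iso1.
have cAlt : #|'Alt_('I_5)| = 60.
  by apply: double_inj; rewrite -mul2n card_Alt card_ord.
(* The exact order of A0 is inherited from [G1], which is one of its conjugates. *)
have cA0 : #|A0| = 60 by rewrite -(cardJg A0 h) -eG1 (card_isog iso1).
exists _, Q0; split; first exact: Q0_homg.
exists (twist h); split; first exact: twist_im.
rewrite eG1; apply: preimages_not_isog => //; first by rewrite (card_isog iso2).
move=> g gP eG2; case/negP: nconj; apply/imsetP; exists g => //.
by rewrite eG1.
Qed.
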